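(* Let $\varphi_N(x)=e^{2\pi \mathrm{i}Nx}\chi_{[0,1]}(x)$, $x\in\mathbb{R}_+$, for $N=1,2,\dots$. Then $$s_n(Q_{\varphi_N})\asymp\min\Bigl\{\frac1{n+1},\frac{N}{(n+1)^2}\Bigr\}\qquad(n\ge0,\ N\ge1),$$ and so $$\|Q_{\varphi_N}\|_{\boldsymbol{S}_1}\asymp\log(N+1)\qquad(N\ge1).$$
   Context: $\mathbb{R}_+=(0,\infty)$; $\chi_{[0,1]}$ is the characteristic function of $[0,1]$. For a function $\varphi$ on $\mathbb{R}_+$, $Q_\varphi$ is the integral operator on $L^2(\mathbb{R}_+)$ given by $(Q_\varphi f)(x)=\int_0^\infty\varphi(\max\{x,y\})f(y)\,dy$. The singular numbers are $s_n(T)=\inf\{\|T-R\|:\operatorname{rank}R\le n\}$, $n\ge0$, and $\|T\|_{\boldsymbol{S}_1}=\sum_{n\ge0}s_n(T)$. The notation $\asymp$ means that the ratio of the two sides is bounded from above and below by positive constants not depending on $n$ or $N$. *)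

(* Defs.v *)
From HB Require Import structures.
From mathcomp Require Import all_boot all_order all_algebra.
From mathcomp Require Import all_classical all_reals all_analysis.
From mathcomp Require Import complex.

Set Implicit Arguments.
Unset Strict Implicit.
Unset Printing Implicit Defensive.

Import Order.TTheory GRing.Theory Num.Theory.

Local Open Scope classical_set_scope.
Local Open Scope ring_scope.
Local Open Scope complex_scope.

Section L2_operators.
Context {R : realType}.

Local Notation mu := (@lebesgue_measure R).

Definition Rplus : set R := `]0, +oo[.

Definition L2norm (f : R -> R[i]) : \bar R :=
  ((\int[mu]_(x in Rplus) (Normc.normc (f x) ^+ 2)%:E) `^ 2^-1)%E.

(* Elements of the complex space L^2(0, +oo) are represented by functions on R,
   two functions being identified when [ae_eq mu Rplus] holds; the values
   outside (0, +oo) are irrelevant. *)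
Definition L2 (f : R -> R[i]) : Prop :=
  [/\ measurable_fun Rplus (fun x => complex.Re (f x)),
      measurable_fun Rplus (fun x => complex.Im (f x)) &
      (L2norm f < +oo)%E].

Definition operator := (R -> R[i]) -> (R -> R[i]).

Definition opnorm (T : operator) : \bar R :=
  ereal_sup [set L2norm (T f) | f in [set f | L2 f /\ (L2norm f <= 1)%E]].

(* Linearity together with boundedness forces T to respect a.e. equality, so T is
   a bounded operator on the quotient space. *)
Record bounded_operator (T : operator) : Prop := BoundedOperator {
  bounded_operator_L2 : forall f, L2 f -> L2 (T f);
  bounded_operator_linear : forall (a : R[i]) f g, L2 f -> L2 g ->
    ae_eq mu Rplus (T (fun x => a * f x + g x)) (fun x => a * T f x + T g x);
  bounded_operator_opnorm : (opnorm T < +oo)%E }.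

Definition rank_le (n : nat) (T : operator) : Prop :=
  exists2 g : 'I_n -> R -> R[i], (forall i, L2 (g i)) &
    forall f, L2 f -> exists c : 'I_n -> R[i],
      ae_eq mu Rplus (T f) (fun x => \sum_(i < n) c i * g i x).

Definition singular_number (T : operator) (n : nat) : \bar R :=
  ereal_inf [set opnorm (fun f x => T f x - K f x) | K in
    [set K : operator | bounded_operator K /\ rank_le n K]].

Definition trace_norm (T : operator) : \bar R :=
  (\sum_(0 <= n <oo) singular_number T n)%E.

Definition Cintegral (f : R -> R[i]) : R[i] :=
  (\int[mu]_(y in Rplus) complex.Re (f y)) +i*
  (\int[mu]_(y in Rplus) complex.Im (f y)).

Definition Q (phi : R -> R[i]) : operator :=
  fun f x => Cintegral (fun y => phi (Num.max x y) * f y).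

Definition cexpi (t : R) : R[i] := cos t +i* sin t.

Definition phi_ (N : nat) (x : R) : R[i] :=
  cexpi (2 * pi * N%:R * x) * (\1_`[0, 1] x)%:C.

End L2_operators.

(* Main.v *)
Require Import Defs.
From HB Require Import structures.
From mathcomp Require Import all_boot all_order all_algebra.
From mathcomp Require Import all_classical all_reals all_analysis.
From mathcomp Require Import measurable_realfun.
From mathcomp Require Import complex.
From mathcomp Require Import ring lra zify.

Set Implicit Arguments.
Unset Strict Implicit.
Unset Printing Implicit Defensive.

Import Order.TTheory GRing.Theory Num.Theory.
Import numFieldNormedType.Exports.

Local Open Scope classical_set_scope.
Local Open Scope ring_scope.

(** Cut ]0, 1] into [m] blocks of length [1 / m].  The kernel
    [phi (max x y)], with [phi x = exp (2 pi i N x)], separates off the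
    diagonal blocks: below the diagonal it is [phi x], above it is [phi y].

    Upper bound.  Keep the kernel off the diagonal blocks and put a constant on
    each of them.  On the rows of one block the resulting operator takes values
    in the span of [phi] and [1], so it has rank at most [2 m]
    ([block_approx]).  The error is block diagonal, and its kernel is bounded
    both by [2] and, since [phi] is Lipschitz with constant of order [N] and the
    blocks have length [1 / m], by a multiple of [N / m].  A block diagonal
    kernel bounded by [B] gives an operator of norm at most [B / m]
    ([block_diagonal_opnorm]).  For [n >= 2], taking [m = n / 2] gives
    both halves of the upper bound at once ([singular_number_upper]).

    Lower bound.  Let [f] be supported in a block, and orthogonal both to [1]
    and to the conjugate of [phi].  Then [Q f] is supported in the same block,
    and two integrations by parts show how to prescribe it: for a function [G]
    vanishing to second order at the ends of the block,
    [f = (G' / (2 pi i N phi))'] satisfies [Q f = G] ([Q_bump_trial]).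
    A block of length [h] and [G] the square of a quadratic polynomial give
    [|Q f| >= c min (h, N h ^ 2) |f|] in norm.  With [h = 1 / (n + 1)] the
    [n + 1] trial functions so obtained have disjoint supports, and so do their
    images, so the same inequality holds on their span; an operator of rank at
    most [n] vanishes at some nonzero element of this span
    ([rank_le_kernel]), whence [singular_number_lower].

    Trace norm.  The terms with [n < N] contribute a harmonic sum, comparable
    to [ln (N + 1)], and the others a bounded amount ([sum_rate_lower],
    [sum_rate_upper]). *)

(** * Squared modulus and squared L2 norm *)

Section squared_norm.
Context {R : realType}.
Local Notation mu := (@lebesgue_measure R).
Implicit Types (f g w : R -> R[i]) (z : R[i]).

(** The squared modulus is used throughout instead of the modulus: it is a
    polynomial in the real and imaginary parts. *)
Definition csq z : R := complex.Re z ^+ 2 + complex.Im z ^+ 2.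

Lemma normc_sq z : Normc.normc z ^+ 2 = csq z.
Proof.
by case: z => a b; rewrite /Normc.normc sqr_sqrtr// addr_ge0// sqr_ge0.
Qed.

Lemma csq_ge0 z : 0 <= csq z.
Proof. by rewrite addr_ge0// sqr_ge0. Qed.

Lemma csq0 : csq 0 = 0.
Proof. by rewrite /csq /= expr0n/= addr0. Qed.

Lemma csqM z1 z2 : csq (z1 * z2) = csq z1 * csq z2.
Proof. by case: z1 => a b; case: z2 => c d; rewrite /csq/=; ring. Qed.

Lemma csqN z : csq (- z) = csq z.
Proof. by case: z => a b; rewrite /csq/= !sqrrN. Qed.

Lemma csq_real (a : R) : csq a%:C%C = a ^+ 2.
Proof. by rewrite /csq/= expr0n/= addr0. Qed.

Lemma csq_gt0 z : z != 0 -> 0 < csq z.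
Proof.
case: z => a b; rewrite eq_complex /= negb_and /csq/=.
by move=> /orP[h|h]; [rewrite ltr_wpDr ?sqr_ge0// exprn_even_gt0
  | rewrite ltr_wpDl ?sqr_ge0// exprn_even_gt0].
Qed.

Lemma csqD_le z1 z2 : csq (z1 + z2) <= 2 * csq z1 + 2 * csq z2.
Proof.
case: z1 => a b; case: z2 => c d; rewrite /csq/=.
have := sqr_ge0 (a - c); have := sqr_ge0 (b - d); nra.
Qed.

Lemma norm_ReImM_le z1 z2 :
  `|complex.Re (z1 * z2)| <= csq z1 + csq z2 /\
  `|complex.Im (z1 * z2)| <= csq z1 + csq z2.
Proof.
case: z1 => a b; case: z2 => c d; rewrite /csq/= !ler_norml.
have := sqr_ge0 (a + c); have := sqr_ge0 (a - c); have := sqr_ge0 (b + d).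
have := sqr_ge0 (b - d); have := sqr_ge0 (a + d); have := sqr_ge0 (a - d).
have := sqr_ge0 (b + c); have := sqr_ge0 (b - c).
have := sqr_ge0 a; have := sqr_ge0 b; have := sqr_ge0 c; have := sqr_ge0 d.
by rewrite !expr2; move=> *; split; apply/andP; split; lra.
Qed.

Lemma csq_sum_le n (F : 'I_n -> R[i]) :
  csq (\sum_(i < n) F i) <= n%:R * \sum_(i < n) csq (F i).
Proof.
elim: n F => [|n IH] F; first by rewrite !big_ord0 csq0 mulr0.
rewrite !(big_ord_recr n)/=.
set A := \sum_(i < n) F _; set S := \sum_(i < n) csq _.
have {IH} : csq A <= n%:R * S by exact: IH.
have [n0|n0] := eqVneq n 0%N.
  have -> : A = 0 by rewrite /A; clear -n0; subst n; rewrite big_ord0.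
  have -> : S = 0 by rewrite /S; clear -n0; subst n; rewrite big_ord0.
  have -> : n.+1%:R = 1 :> R by rewrite n0.
  by rewrite !add0r mul1r.
have np : 0 < n%:R :> R by rewrite ltr0n lt0n.
rewrite -natr1; case: A => a b; case: (F ord_max) => c d; rewrite /csq/= => h.
have h1 : 0 <= (a - n%:R * c) ^+ 2 by exact: sqr_ge0.
have h2 : 0 <= (b - n%:R * d) ^+ 2 by exact: sqr_ge0.
rewrite -(ler_pM2l np); nra.
Qed.

Definition energy f : \bar R := (\int[mu]_(x in Rplus) (csq (f x))%:E)%E.

Definition Cmeasurable f : Prop :=
  measurable_fun Rplus (fun x => complex.Re (f x)) /\
  measurable_fun Rplus (fun x => complex.Im (f x)).

Lemma measurable_Rplus : measurable (Rplus : set (measurableTypeR R)).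
Proof. exact: measurable_itv. Qed.
Hint Resolve measurable_Rplus : core.

Lemma energy_ge0 f : (0 <= energy f)%E.
Proof. by apply: integral_ge0 => x _; rewrite lee_fin csq_ge0. Qed.

Lemma L2normE f : L2norm f = (energy f `^ 2^-1)%E.
Proof.
by rewrite /L2norm; congr (_ `^ _)%E; apply: eq_integral => x _; rewrite normc_sq.
Qed.

Lemma L2norm_sqrte f : L2norm f = sqrte (energy f).
Proof. by rewrite L2normE poweR12_sqrt// energy_ge0. Qed.

Lemma L2norm_leP f (r : R) : 0 <= r ->
  (L2norm f <= r%:E)%E <-> (energy f <= (r ^+ 2)%:E)%E.
Proof.
move=> r0; rewrite L2norm_sqrte.
have := energy_ge0 f; case: (energy f) => [e|//|//].
rewrite /= !lee_fin => e0.
rewrite -[X in Num.sqrt e <= X](ger0_norm r0) -sqrtr_sqr.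
by rewrite ler_sqrt// sqr_ge0.
Qed.

Lemma L2norm_geP f (r : R) : 0 <= r ->
  (r%:E <= L2norm f)%E <-> ((r ^+ 2)%:E <= energy f)%E.
Proof.
move=> r0; rewrite L2norm_sqrte.
have := energy_ge0 f; case: (energy f) => [e|//|//]; last by rewrite /= !leey.
rewrite /= !lee_fin => e0.
rewrite -[X in X <= Num.sqrt _](ger0_norm r0) -sqrtr_sqr.
by rewrite ler_sqrt.
Qed.

Lemma L2P f : L2 f <-> Cmeasurable f /\ (energy f < +oo)%E.
Proof.
rewrite /L2; split.
- move=> [mr mi]; rewrite L2norm_sqrte => h; split; first by [].
  by move: h; case: (energy f) => [e||]; rewrite ?ltry ?ltNyr.
- move=> [[mr mi] h]; split => //; rewrite L2norm_sqrte.
  by move: h (energy_ge0 f); case: (energy f) => [e|//|//] _ _; rewrite ltry.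
Qed.

(** Monotonicity of the integral of nonnegative functions holds without any
    measurability, by its definition as a supremum over simple functions below
    the integrand; it spares a proof that the output of an operator is
    measurable. *)
Lemma ge0_le_integral_nomeas (D : set R) (f1 f2 : R -> \bar R) :
  (forall x, D x -> (0 <= f1 x)%E) -> (forall x, D x -> (f1 x <= f2 x)%E) ->
  (\int[mu]_(x in D) f1 x <= \int[mu]_(x in D) f2 x)%E.
Proof.
move=> f10 f12; rewrite !ge0_integralE//; last first.
  by move=> x Dx; exact: le_trans (f10 _ Dx) (f12 _ Dx).
apply: ge_ereal_sup => _ [h /= hf <-]; apply: ereal_sup_ubound => /=.
exists h => // x; apply: le_trans (hf x) _.
by rewrite /patch; case: ifPn => //; rewrite inE => /f12.
Qed.

End squared_norm.
#[global] Hint Resolve measurable_Rplus : core.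

(** * Complex L2 functions and their integrals *)

Section complex_integral.
Context {R : realType}.
Local Notation mu := (@lebesgue_measure R).
Implicit Types (f g w : R -> R[i]) (z a : R[i]).

Lemma CmeasurableD f g : Cmeasurable f -> Cmeasurable g ->
  Cmeasurable (fun x => f x + g x).
Proof.
move=> [fr fi] [gr gi]; split.
- rewrite (_ : (fun _ => _) = (fun x => complex.Re (f x) + complex.Re (g x))).
    exact: measurable_funD.
  by apply/funext => x; case: (f x) => ? ?; case: (g x).
- rewrite (_ : (fun _ => _) = (fun x => complex.Im (f x) + complex.Im (g x))).
    exact: measurable_funD.
  by apply/funext => x; case: (f x) => ? ?; case: (g x).
Qed.

Lemma CmeasurableM f g : Cmeasurable f -> Cmeasurable g ->
  Cmeasurable (fun x => f x * g x).
Proof.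
move=> [fr fi] [gr gi]; split.
- rewrite (_ : (fun _ => _) = (fun x => complex.Re (f x) * complex.Re (g x)
     - complex.Im (f x) * complex.Im (g x))).
    by apply: measurable_funB; exact: measurable_funM.
  by apply/funext => x; case: (f x) => ? ?; case: (g x).
- rewrite (_ : (fun _ => _) = (fun x => complex.Re (f x) * complex.Im (g x)
     + complex.Im (f x) * complex.Re (g x))).
    by apply: measurable_funD; exact: measurable_funM.
  by apply/funext => x; case: (f x) => ? ?; case: (g x).
Qed.

Lemma Cmeasurable_cst z : Cmeasurable (fun=> z).
Proof. by split; exact: measurable_cst. Qed.

Definition char (A : set R) (x : R) : R[i] := (\1_A x)%:C%C.

Lemma char1 (A : set R) x : A x -> char A x = 1.
Proof. by move=> Ax; rewrite /char indicE mem_set. Qed.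

Lemma char0 (A : set R) x : ~ A x -> char A x = 0.
Proof. by move=> Ax; rewrite /char indicE memNset. Qed.

Lemma csq_char (A : set R) x : csq (char A x) = \1_A x.
Proof.
by rewrite /char csq_real indicE; case: (_ \in _); rewrite ?expr1n ?expr0n.
Qed.

Lemma Cmeasurable_char (A : set R) : measurable A -> Cmeasurable (char A).
Proof.
by move=> mA; split => /=; [exact: measurable_indic|exact: measurable_cst].
Qed.

Lemma Cmeasurable_sum n (F : 'I_n -> R -> R[i]) :
  (forall i, Cmeasurable (F i)) -> Cmeasurable (fun x => \sum_(i < n) F i x).
Proof.
elim: n F => [|n IH] F mF.
  rewrite (_ : (fun _ => _) = fun=> 0); first exact: Cmeasurable_cst.
  by apply/funext => x; rewrite big_ord0.
rewrite (_ : (fun _ => _) =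
    fun x => \sum_(i < n) F (widen_ord (leqnSn n) i) x + F ord_max x).
  by apply: CmeasurableD; [exact: IH|].
by apply/funext => x; rewrite big_ord_recr.
Qed.

Lemma measurable_csq f : Cmeasurable f ->
  measurable_fun (Rplus : set R) (fun x => (csq (f x))%:E).
Proof.
move=> [fr fi]; apply/measurable_EFinP.
by apply: measurable_funD; exact: measurable_funX.
Qed.

Lemma L2_cmeas f : L2 f -> Cmeasurable f.
Proof. by move/L2P => []. Qed.

Lemma L2_energy f : L2 f -> (energy f < +oo)%E.
Proof. by move/L2P => []. Qed.

Lemma energyZ a f : Cmeasurable f ->
  (energy (fun x => (a * f x)%R) = (csq a)%:E * energy f)%E.
Proof.
move=> mf; rewrite /energy -(ge0_integralZl mu (@measurable_Rplus R))//; last 3 first.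
- exact: measurable_csq.
- by move=> x _; rewrite lee_fin csq_ge0.
- by rewrite lee_fin csq_ge0.
by apply: eq_integral => x _; rewrite csqM EFinM.
Qed.

Lemma energyD_le f g : Cmeasurable f -> Cmeasurable g ->
  (energy (fun x => (f x + g x)%R) <= 2%:E * energy f + 2%:E * energy g)%E.
Proof.
move=> mf mg; rewrite /energy -!(ge0_integralZl mu (@measurable_Rplus R))//;
  try by [exact: measurable_csq | move=> x _; rewrite lee_fin csq_ge0].
rewrite -(ge0_integralD mu (@measurable_Rplus R))//; last 4 first.
- by move=> x _; rewrite lee_fin mulr_ge0// csq_ge0.
- by apply: measurable_funeM; exact: measurable_csq.
- by move=> x _; rewrite lee_fin mulr_ge0// csq_ge0.
- by apply: measurable_funeM; exact: measurable_csq.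
apply: ge0_le_integral_nomeas => x _; first by rewrite lee_fin csq_ge0.
by rewrite -!EFinM -EFinD lee_fin csqD_le.
Qed.

Lemma L2Z a f : L2 f -> L2 (fun x => a * f x).
Proof.
move=> /L2P[mf ef]; apply/L2P; split.
  by apply: CmeasurableM => //; exact: Cmeasurable_cst.
rewrite energyZ//; move: ef (energy_ge0 f).
by case: (energy f) => [e|//|//] _ _; rewrite -EFinM ltry.
Qed.

Lemma L2D f g : L2 f -> L2 g -> L2 (fun x => f x + g x).
Proof.
move=> /L2P[mf ef] /L2P[mg eg]; apply/L2P; split; first exact: CmeasurableD.
apply: le_lt_trans (energyD_le mf mg) _.
move: ef eg (energy_ge0 f) (energy_ge0 g).
case: (energy f) => [e|//|//]; case: (energy g) => [e'|//|//] _ _ _ _.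
by rewrite -!EFinM -EFinD ltry.
Qed.

Lemma L2_0 : L2 (fun=> 0 : R[i]).
Proof.
apply/L2P; split; first exact: Cmeasurable_cst.
rewrite /energy integral0_eq ?ltry// => x _.
by rewrite csq0.
Qed.

Lemma L2_sum n (F : 'I_n -> R -> R[i]) :
  (forall i, L2 (F i)) -> L2 (fun x => \sum_(i < n) F i x).
Proof.
elim: n F => [|n IH] F mF.
  rewrite (_ : (fun _ => _) = fun=> 0); first exact: L2_0.
  by apply/funext => x; rewrite big_ord0.
rewrite (_ : (fun _ => _) =
    fun x => \sum_(i < n) F (widen_ord (leqnSn n) i) x + F ord_max x).
  by apply: L2D; [exact: IH|].
by apply/funext => x; rewrite big_ord_recr.
Qed.

Lemma energy_sum_le n (c : 'I_n -> R[i]) (g : 'I_n -> R -> R[i]) :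
  (forall i, Cmeasurable (g i)) ->
  (energy (fun x => (\sum_(i < n) c i * g i x)%R) <=
   n%:R%:E * \sum_(i < n) (csq (c i))%:E * energy (g i))%E.
Proof.
move=> mg.
have mcg i : Cmeasurable (fun x => c i * g i x).
  by apply: CmeasurableM => //; exact: Cmeasurable_cst.
under eq_bigr do rewrite -energyZ//.
rewrite /energy -(ge0_integral_sum mu (@measurable_Rplus R))//; last 2 first.
- by move=> i; exact: measurable_csq.
- by move=> i x _; rewrite lee_fin csq_ge0.
rewrite -(ge0_integralZl mu (@measurable_Rplus R))//; last 2 first.
- by apply: emeasurable_sum => i; exact: measurable_csq.
- by move=> x _; apply: sume_ge0 => i _; rewrite lee_fin csq_ge0.
apply: ge0_le_integral_nomeas => x _; first by rewrite lee_fin csq_ge0.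
by rewrite sumEFin -EFinM lee_fin csq_sum_le.
Qed.

Lemma integral_indic_itv (a b : R) : 0 <= a -> a <= b ->
  (\int[mu]_(x in Rplus) (\1_(`]a, b]) x)%:E)%E = (b - a)%:E.
Proof.
move=> a0 ab; rewrite (integral_indic mu (@measurable_Rplus R))// setIidl.
  apply: etrans (lebesgue_measure_itv `]a, b]) _ => /=.
  rewrite lte_fin -EFinB; case: ltP => // ba.
  by rewrite (_ : a = b) ?subrr//; apply/eqP; rewrite eq_le ab ba.
move=> x; rewrite /Rplus /= !in_itv/= andbT => /andP[ax _].
exact: le_lt_trans ax.
Qed.

Lemma measurable_indic_itv (a b : R) :
  measurable_fun (Rplus : set (measurableTypeR R))
    (fun x => (\1_(`]a, b]) x : R)%:E).
Proof.
apply/measurable_EFinP.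
exact: (@measurable_indic _ _ _ _ (`]a, b]%classic) (measurable_itv _)).
Qed.

Lemma energy_le_interval w (a b B : R) : 0 <= a -> a <= b -> 0 <= B ->
  (forall x, 0 < x -> csq (w x) <= B * \1_(`]a, b]) x) ->
  (energy w <= (B * (b - a))%:E)%E.
Proof.
move=> a0 ab B0 wB.
apply: (@le_trans _ _ (\int[mu]_(x in Rplus) (B%:E * (\1_(`]a, b]) x)%:E))%E).
  apply: ge0_le_integral_nomeas => x; first by rewrite lee_fin csq_ge0.
  by rewrite /Rplus/= in_itv/= andbT => x0; rewrite -EFinM lee_fin wB.
rewrite (ge0_integralZl mu (@measurable_Rplus R))//; last first.
  exact: measurable_indic_itv.
by rewrite integral_indic_itv// EFinM.
Qed.

Lemma L2_bounded w (a b B : R) : Cmeasurable w -> 0 <= a -> a <= b -> 0 <= B ->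
  (forall x, 0 < x -> csq (w x) <= B * \1_(`]a, b]) x) -> L2 w.
Proof.
move=> mw a0 ab B0 wB; apply/L2P; split => //.
by apply: le_lt_trans (energy_le_interval a0 ab B0 wB) _; rewrite ltry.
Qed.

Lemma L2_char (a b : R) : 0 <= a -> a <= b -> L2 (char `]a, b]).
Proof.
move=> a0 ab; apply: (L2_bounded _ a0 ab ler01).
  by apply: Cmeasurable_char; exact: measurable_itv.
by move=> y y0; rewrite mul1r csq_char.
Qed.

Lemma L2_charM (A : set R) f : measurable A -> L2 f -> L2 (fun y => char A y * f y).
Proof.
move=> mA Lf; apply/L2P; split.
  by apply: CmeasurableM; [exact: Cmeasurable_char|exact: L2_cmeas].
apply: le_lt_trans (L2_energy Lf); apply: ge0_le_integral_nomeas => y _.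
  by rewrite lee_fin csq_ge0.
rewrite lee_fin csqM csq_char indicE.
by case: (y \in A); rewrite ?mul1r// mul0r csq_ge0.
Qed.

Definition Cintegrable f : Prop :=
  mu.-integrable Rplus (fun x => (complex.Re (f x))%:E) /\
  mu.-integrable Rplus (fun x => (complex.Im (f x))%:E).

Let integrableZ (r : R) (u : R -> R) :
  mu.-integrable Rplus (fun x => (u x)%:E) ->
  mu.-integrable Rplus (fun x => (r * u x)%:E).
Proof.
move=> iu; under eq_fun do rewrite EFinM.
exact: (integrableZl (@measurable_Rplus R)).
Qed.

Let integrable_add (u v : R -> R) : mu.-integrable Rplus (fun x => (u x)%:E) ->
  mu.-integrable Rplus (fun x => (v x)%:E) ->
  mu.-integrable Rplus (fun x => (u x + v x)%:E).
Proof.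
move=> iu iv; under eq_fun do rewrite EFinD.
exact: (integrableD (@measurable_Rplus R)).
Qed.

Let Rintegral_lin3 (r s : R) (u v t : R -> R) :
  mu.-integrable Rplus (fun x => (u x)%:E) ->
  mu.-integrable Rplus (fun x => (v x)%:E) ->
  mu.-integrable Rplus (fun x => (t x)%:E) ->
  \int[mu]_(x in Rplus) (r * u x + s * v x + t x) =
  r * \int[mu]_(x in Rplus) u x + s * \int[mu]_(x in Rplus) v x
    + \int[mu]_(x in Rplus) t x.
Proof.
move=> iu iv it.
have iru := integrableZ r iu; have isv := integrableZ s iv.
rewrite (@RintegralD _ _ _ mu _ (fun x => r * u x + s * v x) t (@measurable_Rplus R)
  (integrable_add iru isv) it).
rewrite (@RintegralD _ _ _ mu _ (fun x => r * u x) (fun x => s * v x) (@measurable_Rplus R)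
  iru isv).
by rewrite (@RintegralZl _ _ _ mu _ u r (@measurable_Rplus R) iu)
  (@RintegralZl _ _ _ mu _ v s (@measurable_Rplus R) iv).
Qed.

Lemma Cintegral_lin a f g : Cintegrable f -> Cintegrable g ->
  Cintegral (fun x => a * f x + g x) = a * Cintegral f + Cintegral g.
Proof.
move=> [fr fi] [gr gi]; case: a => p q.
rewrite /Cintegral; apply/eqP; rewrite eq_complex; apply/andP; split; apply/eqP => /=.
- rewrite -mulNr -(Rintegral_lin3 p (- q) fr fi gr).
  by apply: eq_Rintegral => x _; case: (f x) => ? ?; case: (g x) => ? ? /=; ring.
- rewrite -(Rintegral_lin3 p q fi fr gi).
  by apply: eq_Rintegral => x _; case: (f x) => ? ?; case: (g x) => ? ? /=; ring.
Qed.

Lemma Cintegrable_lin a f g : Cintegrable f -> Cintegrable g ->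
  Cintegrable (fun x => a * f x + g x).
Proof.
move=> [fr fi] [gr gi]; case: a => p q; split.
- rewrite (_ : (fun x : R => _) = fun x => ((p * complex.Re (f x) +
    (- q) * complex.Im (f x)) + complex.Re (g x))%:E).
    by apply: integrable_add => //; apply: integrable_add; exact: integrableZ.
  by apply/funext => x; case: (f x) => ? ?; case: (g x) => ? ? /=; congr (_%:E); ring.
- rewrite (_ : (fun x : R => _) = fun x => ((p * complex.Im (f x) +
    q * complex.Re (f x)) + complex.Im (g x))%:E).
    by apply: integrable_add => //; apply: integrable_add; exact: integrableZ.
  by apply/funext => x; case: (f x) => ? ?; case: (g x) => ? ? /=; congr (_%:E); ring.
Qed.

Lemma Cintegrable0 : Cintegrable (fun=> 0).
Proof. by split => /=; exact: integrable0. Qed.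

Lemma Cintegral0 : Cintegral (fun=> 0 : R[i]) = 0.
Proof. by rewrite /Cintegral /= /Rintegral integral0_eq. Qed.

Lemma CintegrableZ a f : Cintegrable f -> Cintegrable (fun x => a * f x).
Proof.
move=> If; have := Cintegrable_lin a If Cintegrable0.
by under eq_fun do rewrite addr0.
Qed.

Lemma CintegralZ a f : Cintegrable f ->
  Cintegral (fun x => a * f x) = a * Cintegral f.
Proof.
move=> If; have := Cintegral_lin a If Cintegrable0.
by under eq_fun do rewrite addr0; rewrite Cintegral0 addr0.
Qed.

Lemma integrable_csq f : L2 f -> mu.-integrable Rplus (fun x => (csq (f x))%:E).
Proof.
move=> /L2P[mf ef]; apply/integrableP; split; first exact: measurable_csq.
apply: le_lt_trans ef; rewrite le_eqVlt; apply/orP; left; apply/eqP.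
by apply: eq_integral => x _; rewrite abse_EFin ger0_norm// csq_ge0.
Qed.

Lemma L2_Cintegrable w f : L2 w -> L2 f -> Cintegrable (fun x => w x * f x).
Proof.
move=> Lw Lf.
have [mr mi] := CmeasurableM (L2_cmeas Lw) (L2_cmeas Lf).
have I := integrableD (@measurable_Rplus R) (integrable_csq Lw)
  (integrable_csq Lf).
have bnd x (u : R) : `|u| <= csq (w x) + csq (f x) ->
    (`|u%:E| <= `|(csq (w x))%:E + (csq (f x))%:E|)%E.
  move=> h; rewrite abse_EFin -EFinD abse_EFin lee_fin.
  by rewrite [X in _ <= X]ger0_norm// addr_ge0// csq_ge0.
split.
- apply: (@le_integrable _ _ _ mu _ (@measurable_Rplus R)
    (fun x => (complex.Re (w x * f x))%:E) _ _ _ I); first exact/measurable_EFinP.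
  by move=> x _; apply: bnd; have [] := norm_ReImM_le (w x) (f x).
- apply: (@le_integrable _ _ _ mu _ (@measurable_Rplus R)
    (fun x => (complex.Im (w x * f x))%:E) _ _ _ I); first exact/measurable_EFinP.
  by move=> x _; apply: bnd; have [] := norm_ReImM_le (w x) (f x).
Qed.

Lemma fine_energy f : L2 f -> ((fine (energy f))%:E = energy f)%E.
Proof.
by move=> /L2P[_]; have := energy_ge0 f; case: (energy f) => [e|//|//].
Qed.

(** The Cauchy-Schwarz inequality, with an upper bound [s] in place of
    [energy w] so that the degenerate case of a null [w] needs no separate
    treatment.  Writing [z] for the integral, integrate the inequality
    [2 * Re (conj z * w * f) <= csq z * csq w / s + s * csq f]. *)
Lemma Cauchy_Schwarz w f (s : R) : L2 w -> L2 f -> 0 < s ->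
  (energy w <= s%:E)%E ->
  ((csq (Cintegral (fun x => (w x * f x)%R)))%:E <= s%:E * energy f)%E.
Proof.
move=> Lw Lf s0 ws; rewrite -fine_energy// -EFinM lee_fin.
have Iwf := L2_Cintegrable Lw Lf.
set z := Cintegral _.
have hz : 2 * csq z <= csq z / s * fine (energy w) + s * fine (energy f).
  pose zw x := z^*%C * (w x * f x).
  have Izw : Cintegrable zw by exact: CintegrableZ.
  have Ez : complex.Re (Cintegral zw) = csq z.
    by rewrite CintegralZ// -/z; case: (z) => a b; rewrite /csq/=; ring.
  rewrite -[X in 2 * X]Ez [X in 2 * X]/(\int[mu]_(x in Rplus) complex.Re (zw x)).
  rewrite -[fine (energy w)]/(\int[mu]_(x in Rplus) csq (w x)).
  rewrite -[fine (energy f)]/(\int[mu]_(x in Rplus) csq (f x)).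
  have I1 := integrable_csq Lw; have I2 := integrable_csq Lf.
  have [Ir _] := Izw.
  have := Rintegral_lin3 (csq z / s) s I1 I2 (integrableZ (- 2) Ir).
  rewrite (@RintegralZl _ _ _ mu _ _ (- 2) (@measurable_Rplus R) Ir) => E.
  rewrite -subr_ge0 -mulNr -E; apply: Rintegral_ge0.
  move=> x _; rewrite /zw; case: (z) => p q; case: (w x) => a b; case: (f x) => c d.
  rewrite /csq/= -(ler_pM2l s0).
  rewrite mulr0 [X in _ <= X](_ : _ = (s * c - (p * a + q * b)) ^+ 2
    + (s * d + (p * b - q * a)) ^+ 2); first by rewrite addr_ge0// sqr_ge0.
  by field; rewrite gt_eqF.
move: ws; rewrite -fine_energy// lee_fin => ws.
have : csq z / s * fine (energy w) <= csq z.
  by rewrite mulrAC ler_pdivrMr// ler_wpM2l// csq_ge0.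
lra.
Qed.

End complex_integral.

(** * Operators: norms, ranks and singular numbers *)

Section operators.
Context {R : realType}.
Local Notation mu := (@lebesgue_measure R).
Implicit Types (f g w : R -> R[i]) (T K : @operator R).

Lemma eq_Cintegral f g : (forall y, 0 < y -> f y = g y) ->
  Cintegral f = Cintegral g.
Proof.
move=> fg; rewrite /Cintegral; congr (_ +i* _)%C; apply: eq_Rintegral => y;
  by rewrite inE /Rplus /= in_itv/= andbT => /fg ->.
Qed.

Lemma opnorm_le T (r : R) : 0 <= r ->
  (forall f, L2 f -> (energy f <= 1)%E -> (energy (T f) <= (r ^+ 2)%:E)%E) ->
  (opnorm T <= r%:E)%E.
Proof.
move=> r0 h; apply: ge_ereal_sup => _ [f /= [Lf f1] <-].
apply/L2norm_leP => //; apply: h => //.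
by move: f1 => /(L2norm_leP _ ler01); rewrite expr1n.
Qed.

Lemma rank_leW (m n : nat) T : (m <= n)%N -> rank_le m T -> rank_le n T.
Proof.
move=> mn [g Lg hg].
pose g' (i : 'I_n) : R -> R[i] := if insub (val i) is Some j then g j else fun=> 0.
exists g'.
  by move=> i; rewrite /g'; case: insub => [j|]; [exact: Lg|exact: L2_0].
move=> f Lf; have [c hc] := hg f Lf.
exists (fun i : 'I_n => if insub (val i) is Some j then c j else 0).
apply: filterS hc => x /[apply] ->.
rewrite /g'; pose F i := (if insub i is Some j then c j else 0) *
  (if insub i is Some j then g j else fun=> 0) x.
rewrite -[RHS]/(\sum_(i < n) F i) -(big_mkord xpredT) (big_cat_nat (n := m))//=.
rewrite big_mkord [X in _ + X]big1_seq ?addr0; last first.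
  move=> i; rewrite mem_index_iota => /andP[_ /andP[mi _]].
  by rewrite /F insubF ?mul0r// ltnNge mi.
by apply: eq_bigr => i _; rewrite /F valK.
Qed.

Lemma singular_number_le T K (n : nat) (r : R) :
  bounded_operator K -> rank_le n K ->
  (opnorm (fun f x => (T f x - K f x)%R) <= r%:E)%E ->
  (singular_number T n <= r%:E)%E.
Proof.
move=> bK rK; apply: le_trans; apply: ereal_inf_lbound.
by exists K.
Qed.

Definition finite_rank n (w g : 'I_n -> R -> R[i]) : @operator R :=
  fun f x => \sum_(i < n) Cintegral (fun y => w i y * f y) * g i x.

Lemma finite_rank_bounded n (w g : 'I_n -> R -> R[i]) :
  (forall i, L2 (w i)) -> (forall i, L2 (g i)) ->
  bounded_operator (finite_rank w g).
Proof.
move=> Lw Lg; split.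
- by move=> f Lf; apply: L2_sum => i; exact: L2Z.
- move=> a f h Lf Lh; apply: aeW => x _.
  rewrite /finite_rank mulr_sumr -big_split/=; apply: eq_bigr => i _.
  rewrite mulrA -mulrDl -Cintegral_lin; [|exact: L2_Cintegrable..].
  by congr (Cintegral _ * _); apply/funext => y; ring.
- pose s i := fine (energy (w i)) + 1.
  have s0 i : 0 < s i by rewrite ltr_wpDl// fine_ge0// energy_ge0.
  pose M := n%:R * \sum_(i < n) s i * fine (energy (g i)).
  have M0 : 0 <= M.
    rewrite mulr_ge0// sumr_ge0// => i _.
    by rewrite mulr_ge0// ?(ltW (s0 i))// fine_ge0// energy_ge0.
  apply: (@le_lt_trans _ _ (M + 1)%:E); last by rewrite ltry.
  apply: opnorm_le; first by rewrite addr_ge0.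
  move=> f Lf f1.
  apply: (@le_trans _ _ M%:E); last by rewrite lee_fin; nra.
  apply: le_trans (energy_sum_le _ _) _; first by move=> i; exact: L2_cmeas.
  rewrite EFinM; apply: lee_wpmul2l; first by rewrite lee_fin.
  rewrite -sumEFin; apply: lee_sum => i _.
  rewrite EFinM fine_energy//; apply: lee_wpmul2r; first exact: energy_ge0.
  apply: le_trans (Cauchy_Schwarz (Lw i) Lf (s0 i) _) _.
    by rewrite -fine_energy// lee_fin /s lerDl.
  by rewrite -[X in (_ <= X)%E]mule1 lee_wpmul2l// lee_fin ltW.
Qed.

Lemma finite_rank_rank n (w g : 'I_n -> R -> R[i]) :
  (forall i, L2 (g i)) -> rank_le n (finite_rank w g).
Proof. by move=> Lg; exists g => // f Lf; eexists; apply: aeW. Qed.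

End operators.

(** * Blocks *)

Section blocks.
Context {R : realType}.
Local Notation mu := (@lebesgue_measure R).
Implicit Types (f g w : R -> R[i]) (T K : @operator R).

(** Half-open blocks, so that they partition ]0, 1] exactly. *)
Definition block (m k : nat) : set R := `]k%:R / m%:R, k.+1%:R / m%:R].

Lemma in_block m k x : block m k x <-> k%:R / m%:R < x <= k.+1%:R / m%:R.
Proof. by rewrite /block /= in_itv/=. Qed.

Lemma block_le1 m k (x : R) : (k < m)%N -> block m k x -> 0 < x <= 1.
Proof.
move=> km /in_block /andP[kx xk]; apply/andP; split.
  by apply: le_lt_trans kx; rewrite divr_ge0.
apply: le_trans xk _; rewrite ler_pdivrMr ?mul1r ?ler_nat//.
by rewrite ltr0n (leq_ltn_trans _ km).
Qed.

Lemma block_endpoints m k : (k < m)%N -> [/\ 0 <= k%:R / m%:R :> R,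
  k%:R / m%:R <= k.+1%:R / m%:R :> R & k.+1%:R / m%:R <= 1 :> R].
Proof.
move=> km; have mp : 0 < m%:R :> R by rewrite ltr0n (leq_ltn_trans _ km).
split; first by rewrite divr_ge0.
  by rewrite ler_pM2r ?invr_gt0// ler_nat.
by rewrite ler_pdivrMr// mul1r ler_nat.
Qed.

Lemma block_length m k : k.+1%:R / m%:R - k%:R / m%:R = m%:R^-1 :> R.
Proof. by rewrite -mulrBl -natrB// subSnn mul1r. Qed.

Lemma block_disjoint m k l (x : R) : block m k x -> block m l x -> k = l.
Proof.
move=> /in_block/andP[kx xk] /in_block/andP[lx xl].
have H a b : a%:R / m%:R < b.+1%:R / m%:R :> R -> (a <= b)%N.
  case: m {kx xk lx xl} => [|m]; first by rewrite invr0 !mulr0 ltxx.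
  by rewrite ltr_pM2r ?ltr_nat ?invr_gt0.
by apply/eqP; rewrite eqn_leq; apply/andP; split; apply: H;
  [exact: lt_le_trans kx xl|exact: lt_le_trans lx xk].
Qed.

Lemma block_cover m (x : R) : 0 < x <= 1 -> (0 < m)%N ->
  exists k : 'I_m, block m k x.
Proof.
move=> /andP[x0 x1] m0.
have mp : 0 < m%:R :> R by rewrite ltr0n.
have : forall j, x <= j%:R / m%:R -> exists k : 'I_j, block m k x.
  elim=> [|j IH] xj; first by move: xj; rewrite mul0r leNgt x0.
  have [/IH [k kx]|jx] := lerP x (j%:R / m%:R).
    by exists (widen_ord (leqnSn j) k).
  by exists ord_max; apply/in_block; rewrite jx.
by apply; rewrite divff// gt_eqF.
Qed.

Lemma indic_block m k l (x : R) : block m k x -> \1_(block m l) x = (l == k)%:R :> R.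
Proof.
move=> kx; rewrite indicE; case: eqP => [->|lk]; first by rewrite mem_set.
by rewrite memNset// => lx; apply: lk; exact: block_disjoint lx kx.
Qed.

Lemma char_block m k l (x : R) : block m k x -> char (block m l) x = (l == k)%:R.
Proof. by move=> kx; rewrite /char (indic_block _ kx); case: eqP. Qed.

(** Here [b] stands for the indicators of the blocks at a point of block [k],
    taken in [R] as well as in [R[i]]. *)
Lemma sum_block (S : pzRingType) m (k : 'I_m) (b : 'I_m -> S) (u : 'I_m -> S) :
  (forall l, b l = (l == k :> nat)%:R) -> \sum_(l < m) b l * u l = u k.
Proof.
move=> hb; rewrite (bigD1 k)//= hb eqxx mul1r big1 ?addr0// => l /negPf lk.
by rewrite hb (_ : _ == _ = false)// mul0r.
Qed.

Lemma sum_indic_block_le1 m (x : R) :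
  \sum_(k < m) \1_(block m k) x <= 1 :> R.
Proof.
have [[k kx]|no] := pselect (exists k : 'I_m, block m k x).
  rewrite (bigD1 k)//= (indic_block _ kx) eqxx big1 ?addr0// => l lk.
  by rewrite (indic_block _ kx) (_ : _ == _ = false)//; exact: negbTE.
rewrite big1 // => k _; rewrite indicE memNset// => kx.
by apply: no; exists k.
Qed.

Lemma integral_sum_indic n (a b c : 'I_n -> R) :
  (forall i, 0 <= a i) -> (forall i, a i <= b i) -> (forall i, 0 <= c i) ->
  (\int[mu]_(x in Rplus) (\sum_(i < n) c i * \1_(`]a i, b i]) x)%R%:E)%E =
  (\sum_(i < n) c i * (b i - a i))%:E.
Proof.
move=> a0 ab c0.
under eq_integral do rewrite -sumEFin.
rewrite (ge0_integral_sum mu (@measurable_Rplus R))//; last 2 first.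
- move=> i; under eq_fun do rewrite EFinM.
  by apply: measurable_funeM; exact: measurable_indic_itv.
- by move=> i x _; rewrite lee_fin mulr_ge0.
rewrite -sumEFin; apply: eq_bigr => i _.
under eq_integral do rewrite EFinM.
rewrite (ge0_integralZl mu (@measurable_Rplus R))//; last 2 first.
- exact: measurable_indic_itv.
- by rewrite lee_fin.
by rewrite integral_indic_itv// EFinM.
Qed.

Lemma sum_energy_block_le m f : L2 f ->
  (\sum_(k < m) energy (fun y => char (block m k) y * f y)%R <= energy f)%E.
Proof.
move=> Lf; have mb k : measurable (block m k : set R) by exact: measurable_itv.
rewrite /energy -(ge0_integral_sum mu (@measurable_Rplus R))//; last 2 first.
- by move=> k; apply: measurable_csq; apply: L2_cmeas; exact: L2_charM.
- by move=> k x _; rewrite lee_fin csq_ge0.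
apply: ge0_le_integral_nomeas => x _.
  by apply: sume_ge0 => k _; rewrite lee_fin csq_ge0.
rewrite sumEFin lee_fin.
under eq_bigr do rewrite csqM csq_char.
by rewrite -mulr_suml -[X in _ <= X]mul1r ler_wpM2r ?csq_ge0// sum_indic_block_le1.
Qed.

(** An integral operator that is block diagonal and has kernel at most [B] in
    modulus has norm at most [B / m]: by Cauchy-Schwarz on each block, the
    [k]-th piece of the output has squared norm at most
    [(B / m) ^+ 2] times that of the [k]-th piece of the input. *)
Lemma block_diagonal_opnorm m T (kappa : nat -> R -> R -> R[i]) (B : R) :
  (0 < m)%N -> 0 < B ->
  (forall f x, L2 f -> 1 < x -> T f x = 0) ->
  (forall f k x, L2 f -> (k < m)%N -> block m k x ->
    T f x = Cintegral (fun y => kappa k x y * f y)) ->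
  (forall k x, Cmeasurable (kappa k x)) ->
  (forall k x y, (k < m)%N -> block m k x -> 0 < y ->
    csq (kappa k x y) <= B ^+ 2 * \1_(block m k) y) ->
  (opnorm T <= (B / m%:R)%:E)%E.
Proof.
move=> m0 B0 T1 Tk mk kB.
have mp : 0 < m%:R :> R by rewrite ltr0n.
apply: opnorm_le; first by rewrite divr_ge0 ?ltW.
move=> f Lf f1.
pose fk k y := char (block m k) y * f y.
have Lfk k : L2 (fk k) by apply: L2_charM => //; exact: measurable_itv.
pose e k := fine (energy (fk k)).
have e0 k : 0 <= e k by rewrite fine_ge0// energy_ge0.
have pt x : 0 < x ->
    csq (T f x) <= \sum_(k < m) (B ^+ 2 / m%:R * e k) * \1_(block m k) x.
  move=> x0; have [x1|x1] := ltP 1 x.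
    rewrite T1// csq0 sumr_ge0// => k _.
    by rewrite mulr_ge0// mulr_ge0// divr_ge0 ?sqr_ge0// ltW.
  have /block_cover/(_ m0)[k kx] : 0 < x <= 1 by rewrite x0.
  under eq_bigr do rewrite mulrC.
  rewrite (sum_block (k := k) _ (fun l : 'I_m => indic_block l kx)).
  rewrite (Tk _ _ _ Lf (ltn_ord k) kx).
  have -> : Cintegral (fun y => kappa k x y * f y) =
      Cintegral (fun y => kappa k x y * fk k y).
    apply: eq_Cintegral => y y0; rewrite /fk mulrA; congr (_ * _).
    have [yk|yk] := pselect (block m k y); first by rewrite char1// mulr1.
    rewrite char0// mulr0; have := kB k x y (ltn_ord k) kx y0.
    rewrite indicE memNset// mulr0 => h; apply: contraTeq h => /csq_gt0.
    by rewrite ltNge.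
  have mB : 0 < B ^+ 2 / m%:R by rewrite divr_gt0// exprn_gt0.
  have kb y : 0 < y -> csq (kappa k x y) <= B ^+ 2 * \1_(block m k) y.
    by move=> y0; exact: kB.
  have [k0 kk _] := block_endpoints (ltn_ord k).
  have B2 : 0 <= B ^+ 2 by rewrite sqr_ge0.
  have := Cauchy_Schwarz (L2_bounded (mk k x) k0 kk B2 kb) (Lfk k) mB.
  rewrite -(fine_energy (Lfk k)) -EFinM lee_fin; apply.
  by have := energy_le_interval k0 kk B2 kb; rewrite block_length.
apply: (@le_trans _ _ (\int[mu]_(x in Rplus)
    (\sum_(k < m) (B ^+ 2 / m%:R * e k) * \1_(block m k) x)%R%:E)%E).
  apply: ge0_le_integral_nomeas => x; first by rewrite lee_fin csq_ge0.
  by rewrite /Rplus /= in_itv/= andbT => x0; rewrite lee_fin pt.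
rewrite integral_sum_indic; last 3 first.
- by move=> k; have [] := block_endpoints (ltn_ord k).
- by move=> k; have [] := block_endpoints (ltn_ord k).
- by move=> k; rewrite mulr_ge0// divr_ge0 ?sqr_ge0// ltW.
rewrite lee_fin.
have es : \sum_(k < m) e k <= 1.
  rewrite -lee_fin -sumEFin; apply: le_trans f1.
  apply: le_trans (sum_energy_block_le m Lf).
  by apply: lee_sum => k _; rewrite fine_energy.
under eq_bigr do rewrite block_length mulrAC.
rewrite -mulr_sumr expr_div_n -[X in _ <= X]mulr1.
rewrite [X in X * _ <= _](_ : _ = B ^+ 2 / m%:R ^+ 2); last by field; rewrite gt_eqF.
by apply: ler_wpM2l => //; rewrite divr_ge0// sqr_ge0.
Qed.

End blocks.
Arguments block_endpoints R {m k}.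

(** * The symbol *)

Section symbol.
Context {R : realType}.
Local Notation mu := (@lebesgue_measure R).
Implicit Types (f g w : R -> R[i]) (N m n k : nat) (x y t : R).

Lemma csq_cexpi t : csq (cexpi t) = 1.
Proof. by rewrite /csq /= cos2Dsin2. Qed.

Lemma cexpi_lipschitz s t : csq (cexpi s - cexpi t : R[i]) <= 2 * (s - t) ^+ 2.
Proof.
wlog ts : s t / t <= s => [hw|].
  have [|/ltW] := leP t s; first exact: hw.
  by move=> /hw; rewrite -[csq (cexpi t - _)]csqN opprB -sqrrN opprB.
have bnd (u : R) (v : R) : `|u| <= 1 -> (u * v) ^+ 2 <= v ^+ 2.
  move=> u1; rewrite exprMn ler_piMl ?sqr_ge0//.
  by rewrite -(real_normK (num_real u)) exprn_ile1.
have cosL : (cos s - cos t) ^+ 2 <= (s - t) ^+ 2.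
  have [|a _ ->] := @MVT_segment R cos (fun x => - sin x) t s ts.
    by apply: (continuous_subspaceT (@continuous_cos R)).
  by apply: bnd; rewrite normrN sin_max.
have sinL : (sin s - sin t) ^+ 2 <= (s - t) ^+ 2.
  have [|a _ ->] := @MVT_segment R sin cos t s ts.
    by apply: (continuous_subspaceT (@continuous_sin R)).
  by apply: bnd; rewrite cos_max.
by rewrite mulr_natl mulr2n; exact: lerD.
Qed.

Lemma phi_in N x : 0 < x <= 1 -> phi_ N x = cexpi (2 * pi * N%:R * x).
Proof.
move=> /andP[x0 x1]; rewrite /phi_ indicE mem_set ?mulr1//=.
by rewrite in_itv/= x1 ltW.
Qed.

Lemma phi_out N x : 1 < x -> phi_ N x = 0.
Proof.
move=> x1; rewrite /phi_ indicE memNset ?mulr0//= in_itv/= => /andP[_].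
by rewrite leNgt x1.
Qed.

Lemma csq_phi_le N x : csq (phi_ N x) <= \1_`[0, 1] x.
Proof. by rewrite csqM csq_cexpi mul1r csq_real indicE; case: (_ \in _) => /=; lra. Qed.

Lemma continuous_cos_mul (a : R) : continuous (fun x : R => cos (a * x)).
Proof.
move=> x; apply: continuous_comp; first exact: mulrl_continuous.
exact: continuous_cos.
Qed.

Lemma continuous_sin_mul (a : R) : continuous (fun x : R => sin (a * x)).
Proof.
move=> x; apply: continuous_comp; first exact: mulrl_continuous.
exact: continuous_sin.
Qed.

Lemma Cmeasurable_phi_comp N (u : R -> R) : measurable_fun [set: R] u ->
  Cmeasurable (fun x => phi_ N (u x)).
Proof.
move=> mu_; have mI : measurable_fun [set: R] (\1_`[0, 1] : R -> R).
  by apply: measurable_indic; exact: measurable_itv.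
split; apply: measurable_funTS.
- apply: (@measurableT_comp _ _ _ _ _ _ (fun x => complex.Re (phi_ N x))) => //.
  rewrite (_ : (fun _ => _) = fun x => cos (2 * pi * N%:R * x) * \1_`[0, 1] x).
    apply: measurable_funM => //; apply: continuous_measurable_fun.
    exact: continuous_cos_mul.
  by apply/funext => x /=; rewrite mulr0 subr0.
- apply: (@measurableT_comp _ _ _ _ _ _ (fun x => complex.Im (phi_ N x))) => //.
  rewrite (_ : (fun _ => _) = fun x => sin (2 * pi * N%:R * x) * \1_`[0, 1] x).
    apply: measurable_funM => //; apply: continuous_measurable_fun.
    exact: continuous_sin_mul.
  by apply/funext => x /=; rewrite mulr0 add0r.
Qed.

Lemma L2_phi_max N x : L2 (fun y => phi_ N (Num.max x y)).
Proof.
apply: (@L2_bounded _ _ 0 1 1) => //.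
  apply: Cmeasurable_phi_comp; apply: measurable_maxr => //.
move=> y y0; rewrite mul1r; apply: le_trans (csq_phi_le _ _) _.
rewrite !indicE; case: (boolP (_ \in _)) => // /set_mem/=.
rewrite in_itv/= => /andP[_]; rewrite ge_max => /andP[_ y1].
by rewrite mem_set//= in_itv/= y0.
Qed.

Lemma L2_phi N : L2 (phi_ N : R -> R[i]).
Proof.
apply: (@L2_bounded _ _ 0 1 1) => //.
  by apply: (@Cmeasurable_phi_comp N id).
move=> y y0; rewrite mul1r; apply: le_trans (csq_phi_le _ _) _.
rewrite !indicE; case: (boolP (_ \in _)) => // /set_mem/=.
rewrite in_itv/= => /andP[_ y1].
by rewrite mem_set//= in_itv/= y0.
Qed.

End symbol.

(** * Upper bound for the singular numbers *)

Section upper_bound.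
Context {R : realType}.
Local Notation mu := (@lebesgue_measure R).
Implicit Types (f g w : R -> R[i]) (N m n k : nat) (x y t : R).

Lemma Q_out N f x : 1 < x -> Q (phi_ N) f x = 0.
Proof.
move=> x1; rewrite /Q -[RHS]Cintegral0; apply: eq_Cintegral => y y0.
by rewrite phi_out ?mul0r// lt_max x1.
Qed.

Definition phase N m k : R[i] := cexpi (2 * pi * N%:R * (k%:R / m%:R)).

(** [block_kernel] is what remains of the kernel of [Q (phi_ N)] on a diagonal
    block after replacing it there by the constant [phase N m k]. *)
Definition block_kernel N m k x y : R[i] :=
  (phi_ N (Num.max x y) - phase N m k) * char (block m k) y.

(** For [x] in block [k], the kernel of the approximant is [phi_ N x] for [y]
    left of the block, [phase N m k] for [y] in the block and [phi_ N y] for [y]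
    right of it.  Integrating against it gives the combination of [phi_ N] and
    [1] on the block, listed in [coefg], whose coefficients are the integrals
    against the functions in [coefw]. *)
Definition coefw N m (i : 'I_(m + m)) : R -> R[i] :=
  match fintype.split i with
  | inl k => char `]0, k%:R / m%:R]
  | inr k => fun y => phase N m k * char (block m k) y
      + phi_ N y * char `]k.+1%:R / m%:R, 1] y
  end.

Definition coefg N m (i : 'I_(m + m)) : R -> R[i] :=
  match fintype.split i with
  | inl k => fun x => char (block m k) x * phi_ N x
  | inr k => char (block m k)
  end.

Definition block_approx N m : @operator R := finite_rank (@coefw N m) (@coefg N m).

Lemma L2_coefw N m i : L2 (@coefw N m i).
Proof.
rewrite /coefw; case: fintype.split => k; have [k0 kk k1] := block_endpoints R (ltn_ord k).
  exact: L2_char.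
apply: L2D; first by apply: L2Z; exact: L2_char.
under eq_fun do rewrite mulrC; apply: L2_charM; [exact: measurable_itv|exact: L2_phi].
Qed.

Lemma L2_coefg N m i : L2 (@coefg N m i).
Proof.
rewrite /coefg; case: fintype.split => k; have [k0 kk k1] := block_endpoints R (ltn_ord k).
  by apply: L2_charM; [exact: measurable_itv|exact: L2_phi].
exact: L2_char.
Qed.

Lemma block_approx_out N m f x : 1 < x -> block_approx N m f x = 0.
Proof.
move=> x1; rewrite /block_approx /finite_rank big1// => i _.
rewrite /coefg; case: fintype.split => k.
  by rewrite phi_out// !mulr0.
rewrite char0 ?mulr0// => /block_le1 -/(_ (ltn_ord k))/andP[_].
by rewrite leNgt x1.
Qed.

Lemma block_approx_in N m f x (k : 'I_m) : block m k x ->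
  block_approx N m f x =
  Cintegral (fun y => char `]0, k%:R / m%:R] y * f y) * phi_ N x +
  Cintegral (fun y => (phase N m k * char (block m k) y
      + phi_ N y * char `]k.+1%:R / m%:R, 1] y) * f y).
Proof.
move=> kx; rewrite /block_approx /finite_rank big_split_ord/= /coefw /coefg.
have E1 (i : 'I_m) : fintype.split (lshift m i) = inl i by exact: (unsplitK (inl i)).
have E2 (i : 'I_m) : fintype.split (rshift m i) = inr i by exact: (unsplitK (inr i)).
under eq_bigr do rewrite E1 mulrCA.
under [X in _ + X]eq_bigr do rewrite E2 mulrC.
by congr (_ + _); apply: (sum_block (k := k)) => l; exact: char_block.
Qed.

Lemma Q_sub_block_approx N m f k x : L2 f -> (k < m)%N -> block m k x ->
  Q (phi_ N) f x - block_approx N m f x =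
  Cintegral (fun y => block_kernel N m k x y * f y).
Proof.
move=> Lf km kx; rewrite (block_approx_in N f (k := Ordinal km) kx)/=.
have [k0 kk k1] := block_endpoints R km.
have Lw1 : L2 (char `]0, k%:R / m%:R] : R -> R[i]) by exact: L2_char.
have Lw2 := L2_coefw N (rshift m (Ordinal km)).
rewrite /coefw (unsplitK (inr (Ordinal km))) /= in Lw2.
have I1 := L2_Cintegrable Lw1 Lf.
have I2 := L2_Cintegrable Lw2 Lf.
have I3 := L2_Cintegrable (L2_phi_max N x) Lf.
have -> : Cintegral (fun y => block_kernel N m k x y * f y) =
    Cintegral (fun y => - phi_ N x * (char `]0, k%:R / m%:R] y * f y)
      + (- 1 * ((phase N m k * char (block m k) y
         + phi_ N y * char `]k.+1%:R / m%:R, 1] y) * f y)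
         + phi_ N (Num.max x y) * f y)).
  apply: eq_Cintegral => y y0; rewrite /block_kernel !mulrA -!mulrDl; congr (_ * _).
  have /andP[kx1 kx2] : k%:R / m%:R < x <= k.+1%:R / m%:R by exact/in_block.
  have [yk|ky] := leP y (k%:R / m%:R).
    rewrite (@char1 R `]0, k%:R / m%:R]) /= ?in_itv/= ?y0//.
    rewrite (@char0 R (block m k)); last by move=> /in_block; rewrite ltNge yk.
    rewrite (@char0 R `]k.+1%:R / m%:R, 1]) /= ?in_itv/=; last first.
      by apply/negP; rewrite negb_and -leNgt (le_trans yk).
    by rewrite max_l ?(le_trans yk (ltW kx1))//; ring.
  rewrite (@char0 R `]0, k%:R / m%:R]) /= ?in_itv/=; last first.
    by apply/negP; rewrite negb_and orbC -ltNge ky.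
  have [ky1|yk1] := leP y (k.+1%:R / m%:R).
    rewrite (@char1 R (block m k)); last by apply/in_block; rewrite ky.
    rewrite (@char0 R `]k.+1%:R / m%:R, 1]) /= ?in_itv/=; last first.
      by apply/negP; rewrite negb_and -leNgt ky1.
    by ring.
  rewrite (@char0 R (block m k)); last by move=> /in_block; rewrite leNgt yk1 andbF.
  rewrite max_r ?(le_trans kx2 (ltW yk1))//.
  have [y1|y1] := leP y 1.
    by rewrite (@char1 R `]k.+1%:R / m%:R, 1]) /= ?in_itv/= ?yk1//; ring.
  by rewrite phi_out//; ring.
rewrite Cintegral_lin//; last by exact: Cintegrable_lin.
by rewrite Cintegral_lin// /Q; ring.
Qed.

Lemma block_max m k x y : block m k x -> block m k y -> block m k (Num.max x y).
Proof. by move=> kx ky; case: leP. Qed.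

(** The difference of [Q (phi_ N)] and [block_approx N m] is the block diagonal
    operator with kernel [block_kernel]. *)
Lemma singular_number_block N m n (B : R) : (0 < m)%N -> (m + m <= n)%N -> 0 < B ->
  (forall k z, (k < m)%N -> block m k z -> csq (phi_ N z - phase N m k) <= B ^+ 2) ->
  (singular_number (Q (phi_ N)) n <= (B / m%:R)%:E)%E.
Proof.
move=> m0 mn B0 hB.
apply: (@singular_number_le _ _ (block_approx N m)).
- by apply: finite_rank_bounded => i; [exact: L2_coefw|exact: L2_coefg].
- by apply: rank_leW mn _; apply: finite_rank_rank => i; exact: L2_coefg.
apply: (@block_diagonal_opnorm _ _ _ (block_kernel N m)) => //.
- by move=> f x Lf x1; rewrite Q_out// block_approx_out// subrr.
- by move=> f k x Lf km kx; exact: Q_sub_block_approx.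
- move=> k x; apply: CmeasurableM.
    apply: CmeasurableD; last exact: Cmeasurable_cst.
    by apply: L2_cmeas; exact: L2_phi_max.
  by apply: Cmeasurable_char; exact: measurable_itv.
move=> k x y km kx y0; rewrite /block_kernel csqM csq_char indicE.
case: (boolP (y \in block m k)) => [/set_mem ky|]; last by rewrite !mulr0.
by rewrite !mulr1; apply: hB => //; exact: block_max.
Qed.

Lemma singular_number_le1 N n : (singular_number (Q (phi_ N)) n <= (1 : R)%:E)%E.
Proof.
(* The zero operator is the approximant, and the whole kernel of Q is seen as a
   single diagonal block. *)
pose z (i : 'I_0) : R -> R[i] := fun=> 0.
apply: (@singular_number_le _ _ (finite_rank z z)).
- by apply: finite_rank_bounded => -[].
- by apply: rank_leW (leq0n n) _; apply: finite_rank_rank => -[].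
pose kappa (k : nat) x y := phi_ N (Num.max x y) * char (block 1 k) y.
rewrite -[X in (_ <= X%:E)%E]divr1.
have K0 f x : finite_rank z z f x = 0 by rewrite /finite_rank big_ord0.
apply: (@block_diagonal_opnorm _ 1 _ kappa) => //.
- by move=> f x Lf x1; rewrite Q_out// K0 subrr.
- move=> f k x Lf k0 kx; rewrite K0 subr0; apply: eq_Cintegral => y y0.
  rewrite /kappa; have [y1|y1] := leP y 1.
    rewrite char1 ?mulr1//; move: k0; rewrite ltnS leqn0 => /eqP ->.
    by apply/in_block; rewrite mul0r divr1 y0.
  by rewrite phi_out ?mul0r// lt_max y1 orbT.
- move=> k x; apply: CmeasurableM; first by apply: L2_cmeas; exact: L2_phi_max.
  by apply: Cmeasurable_char; exact: measurable_itv.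
move=> k x y km kx y0; rewrite /kappa csqM csq_char expr1n mul1r.
have c1 : csq (phi_ N (Num.max x y)) <= 1.
  apply: le_trans (csq_phi_le _ _) _; rewrite indicE.
  by case: (_ \in _).
have c0 := csq_ge0 (phi_ N (Num.max x y)).
by rewrite indicE; case: (y \in _) => /=; lra.
Qed.

Lemma phi_phase N m k z : (k < m)%N -> block m k z ->
  csq (phi_ N z - phase N m k) <= 2 ^+ 2 /\
  csq (phi_ N z - phase N m k) <= (2 * (2 * pi * N%:R / m%:R)) ^+ 2.
Proof.
move=> km kz; rewrite phi_in; last exact: block_le1 kz.
rewrite /phase; split.
  by apply: le_trans (csqD_le _ _) _; rewrite csqN !csq_cexpi expr2; lra.
apply: le_trans (cexpi_lipschitz _ _) _; rewrite -mulrBr !exprMn.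
have /in_block/andP[z1 z2] := kz.
have zz : (z - k%:R / m%:R) ^+ 2 <= (m%:R^-1) ^+ 2.
  have z0 : 0 <= z - k%:R / m%:R by rewrite subr_ge0 ltW.
  have z3 : z - k%:R / m%:R <= m%:R^-1.
    by move: z2; rewrite -natr1 mulrDl mul1r; lra.
  by rewrite ler_sqr ?nnegrE// (le_trans z0).
set a := 2 ^+ 2 * pi ^+ 2 * N%:R ^+ 2.
have a0 : 0 <= a by rewrite /a -!exprMn sqr_ge0.
have := ler_wpM2l a0 zz.
have : 0 <= a * m%:R^-1 ^+ 2 by rewrite mulr_ge0// sqr_ge0.
lra.
Qed.

(** Blocks are available only for [n >= 2], with [m = n / 2] of them; for
    [n <= 1] the bound by [1] suffices, because the minimum is then at least
    [1 / 4]. *)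
Lemma singular_number_upper N n : (1 <= N)%N ->
  (singular_number (Q (phi_ N)) n <=
   (256 * Num.min (1 / n.+1%:R) (N%:R / n.+1%:R ^+ 2) : R)%:E)%E.
Proof.
move=> N1.
have NR : 1 <= N%:R :> R by rewrite ler1n.
have np : 0 < n.+1%:R :> R by rewrite ltr0n.
have [n1|n2] := leqP n 1.
  apply: le_trans (singular_number_le1 N n) _; rewrite lee_fin.
  have n2 : n.+1%:R <= 2 :> R by rewrite ler_nat.
  rewrite minElt; case: ifP => _.
    by rewrite mulrA ler_pdivlMr//; lra.
  by rewrite mulrA ler_pdivlMr ?exprn_gt0//; nra.
pose m := n./2.
have m0 : (0 < m)%N by rewrite /m; lia.
have mn : (m + m <= n)%N by rewrite /m; lia.
have nm : (n.+1 <= 4 * m)%N by rewrite /m; lia.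
have mp : 0 < m%:R :> R by rewrite ltr0n.
have nm' : n.+1%:R <= 4 * m%:R :> R by rewrite -natrM ler_nat.
have pi4 : pi < 4 :> R by have := @pihalf_lt2 R; lra.
have pi0 := @pi_gt0 R.
rewrite minElt; case: ifP => _.
  apply: le_trans (@singular_number_block N m n 2 m0 mn _ _) _ => //.
    by move=> k z km kz; have [] := phi_phase N km kz.
  by rewrite lee_fin ler_pdivrMr// mulrA mulrAC ler_pdivlMr//; lra.
apply: le_trans
  (@singular_number_block N m n (2 * (2 * pi * N%:R / m%:R)) m0 mn _ _) _.
- by rewrite !mulr_gt0 ?invr_gt0// ltr0n.
- by move=> k z km kz; have [] := phi_phase N km kz.
rewrite lee_fin.
have -> : 2 * (2 * pi * N%:R / m%:R) / m%:R = 4 * pi * N%:R / m%:R ^+ 2 :> R.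
  by field; rewrite gt_eqF.
rewrite ler_pdivrMr ?exprn_gt0//.
have -> : 256 * (N%:R / n.+1%:R ^+ 2) * m%:R ^+ 2
    = (256 * N%:R * m%:R ^+ 2) / n.+1%:R ^+ 2 :> R by ring.
rewrite ler_pdivlMr ?exprn_gt0//.
have h1 : n.+1%:R ^+ 2 <= 16 * m%:R ^+ 2 :> R by nra.
have h2 : 0 <= 4 * pi * N%:R :> R by rewrite !mulr_ge0// ltW.
apply: le_trans (ler_wpM2l h2 h1) _.
have h3 : 0 <= N%:R * m%:R ^+ 2 :> R by rewrite mulr_ge0// sqr_ge0.
nra.
Qed.

End upper_bound.

(** * Trial functions *)

Section trial_functions.
Local Open Scope complex_scope.
Context {R : realType}.
Local Notation mu := (@lebesgue_measure R).
Implicit Types (f g w : R -> R[i]) (a b o x y : R).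

(** The antiderivative is assumed on the whole line, so that no one-sided limit
    at [a] or [b] appears. *)
Lemma Rintegral_FTC (u U : R -> R) a b : 0 <= a -> a <= b ->
  (forall x : R, is_derive x 1 U (u x)) -> continuous u ->
  \int[mu]_(y in Rplus) (\1_(`]a, b]) y * u y) = U b - U a.
Proof.
move=> a0 ab dU cu.
have -> : \int[mu]_(y in Rplus) (\1_(`]a, b]) y * u y) =
    \int[mu]_(y in `]a, b]) u y.
  rewrite -[in RHS](_ : Rplus `&` `]a, b] = `]a, b]%classic); last first.
    rewrite setIidr// => x; rewrite /Rplus /= !in_itv/= andbT => /andP[ax _].
    exact: le_lt_trans ax.
  rewrite Rintegral_mkcondr; apply: eq_Rintegral => y _.
  by rewrite /patch indicE; case: (_ \in _); rewrite ?mul1r ?mul0r.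
move: ab; rewrite le_eqVlt => /predU1P[<-|ab].
  by rewrite set_itvoc0 Rintegral_set0 subrr.
have cw : {within `[a, b], continuous u} by exact: (continuous_subspaceT cu).
have mu_ : measurable_fun [set: R] u by exact: continuous_measurable_fun.
have cU : continuous U.
  move=> x; apply: differentiable_continuous; apply/derivable1_diffP.
  exact: ex_derive.
rewrite /Rintegral integral_itv_obnd_cbnd; last first.
  by apply/measurable_EFinP; exact: measurable_funTS.
rewrite (continuous_FTC2 ab cw (F := U))//.
- split.
  + by move=> x _; exact: ex_derive.
  + by apply: cvg_at_right_filter; exact: cU.
  + by apply: cvg_at_left_filter; exact: cU.
- by move=> x _; rewrite derive1E derive_val.
Qed.

Lemma Cintegral_FTC f F a b : 0 <= a -> a <= b ->
  (forall x : R, is_derive x 1 (fun y => complex.Re (F y)) (complex.Re (f x))) ->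
  (forall x : R, is_derive x 1 (fun y => complex.Im (F y)) (complex.Im (f x))) ->
  continuous (fun y => complex.Re (f y)) ->
  continuous (fun y => complex.Im (f y)) ->
  Cintegral (fun y => char `]a, b] y * f y) = F b - F a.
Proof.
move=> a0 ab dR dI cR cI.
have hR := Rintegral_FTC a0 ab dR cR; have hI := Rintegral_FTC a0 ab dI cI.
rewrite /Cintegral; apply/eqP; rewrite eq_complex; apply/andP; split; apply/eqP.
  rewrite [LHS]/= (_ : complex.Re (F b - F a) = complex.Re (F b) - complex.Re (F a));
    last by case: (F b) => ? ?; case: (F a).
  rewrite -hR; apply: eq_Rintegral => y _; rewrite /char.
  by case: (f y) => p q /=; rewrite mul0r subr0.
rewrite [LHS]/= (_ : complex.Im (F b - F a) = complex.Im (F b) - complex.Im (F a));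
  last by case: (F b) => ? ?; case: (F a).
rewrite -hI; apply: eq_Rintegral => y _; rewrite /char.
by case: (f y) => p q /=; rewrite mul0r addr0.
Qed.

(** A bump on [a, b] with its first two derivatives; it and [bump1] vanish at
    both ends. *)
Definition bump a b x : R := ((x - a) * (b - x)) ^+ 2.
Definition bump1 a b x : R := 2 * ((x - a) * (b - x)) * (a + b - 2 * x).
Definition bump2 a b x : R := 2 * ((a + b - 2 * x) ^+ 2 - 2 * ((x - a) * (b - x))).

Lemma is_derive_bump a b (x : R) : is_derive x 1 (bump a b) (bump1 a b x).
Proof.
rewrite /bump; apply: is_derive_eq.
rewrite /bump1 /GRing.scale/=; ring.
Qed.

Lemma is_derive_bump1 a b (x : R) : is_derive x 1 (bump1 a b) (bump2 a b x).
Proof.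
rewrite /bump1; apply: is_derive_eq.
rewrite /bump2 /GRing.scale/=; ring.
Qed.

Lemma continuous_bump a b : continuous (bump a b : R -> R).
Proof.
move=> x; apply: differentiable_continuous; apply/derivable1_diffP.
exact: (@ex_derive _ _ _ _ _ _ _ (is_derive_bump a b x)).
Qed.

Lemma continuous_bump1 a b : continuous (bump1 a b : R -> R).
Proof.
move=> x; apply: differentiable_continuous; apply/derivable1_diffP.
exact: (@ex_derive _ _ _ _ _ _ _ (is_derive_bump1 a b x)).
Qed.

Lemma continuous_bump2 a b : continuous (bump2 a b : R -> R).
Proof.
move=> x; apply: differentiable_continuous; apply/derivable1_diffP.
by rewrite /bump2; apply: ex_derive.
Qed.

(** [trial o a b] is the derivative of [exp (- i o x) * bump1 a b x / (i o)],
    which is [trial_int o a b], and its product with the symbol of frequency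
    [o] is [- bump1 a b - i * bump2 a b / o].  Both antiderivatives vanish at
    [a] and [b]. *)
Definition trial o a b x : R[i] :=
  (- cos (o * x) * bump1 a b x - sin (o * x) * bump2 a b x / o) +i*
  (sin (o * x) * bump1 a b x - cos (o * x) * bump2 a b x / o).

Definition trial_int o a b x : R[i] :=
  (- sin (o * x) * bump1 a b x / o) +i* (- cos (o * x) * bump1 a b x / o).

Lemma csq_trial o a b x :
  csq (trial o a b x) = bump1 a b x ^+ 2 + (bump2 a b x / o) ^+ 2.
Proof.
rewrite /csq /trial /=; have := cos2Dsin2 (o * x).
set c := cos _; set s := sin _; set p := bump1 _ _ _; set q := bump2 _ _ _.
move=> cs; transitivity ((c ^+ 2 + s ^+ 2) * (p ^+ 2 + (q / o) ^+ 2)); first by ring.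
by rewrite cs mul1r.
Qed.

Lemma cexpi_trial o a b x : cexpi (o * x) * trial o a b x =
  (- bump1 a b x) +i* (- (bump2 a b x / o)).
Proof.
rewrite /trial /cexpi; have := cos2Dsin2 (o * x).
set c := cos _; set s := sin _; set p := bump1 _ _ _; set q := bump2 _ _ _.
move=> cs; apply/eqP; rewrite eq_complex; apply/andP; split; apply/eqP => /=.
  by transitivity (- ((c ^+ 2 + s ^+ 2) * p)); [ring|rewrite cs mul1r].
by transitivity (- ((c ^+ 2 + s ^+ 2) * (q / o))); [ring|rewrite cs mul1r].
Qed.

Lemma continuous_trial_Re o a b : continuous (fun x => complex.Re (trial o a b x)).
Proof.
move=> x /=; apply: cvgB; apply: cvgM.
- by apply: cvgN; exact: continuous_cos_mul.
- exact: continuous_bump1.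
- by apply: cvgM; [exact: continuous_sin_mul|exact: continuous_bump2].
- exact: cvg_cst.
Qed.

Lemma continuous_trial_Im o a b : continuous (fun x => complex.Im (trial o a b x)).
Proof.
move=> x /=; apply: cvgB; apply: cvgM.
- exact: continuous_sin_mul.
- exact: continuous_bump1.
- by apply: cvgM; [exact: continuous_cos_mul|exact: continuous_bump2].
- exact: cvg_cst.
Qed.

Lemma Cintegral_trial o a b s t : o != 0 -> 0 <= s -> s <= t ->
  Cintegral (fun y => char `]s, t] y * trial o a b y) =
  trial_int o a b t - trial_int o a b s.
Proof.
move=> o0 s0 st; apply: Cintegral_FTC => //.
- move=> x /=; have := is_derive_bump1 a b x => db.
  apply: is_derive_eq; rewrite /GRing.scale/=; field.
  by [].
- move=> x /=; have := is_derive_bump1 a b x => db.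
  apply: is_derive_eq; rewrite /GRing.scale/=; field.
  by [].
- exact: continuous_trial_Re.
- exact: continuous_trial_Im.
Qed.

Lemma Cintegral_phase_trial o a b s t : 0 <= s -> s <= t ->
  Cintegral (fun y => char `]s, t] y * (cexpi (o * y) * trial o a b y)) =
  (bump a b s - bump a b t) +i* ((bump1 a b s - bump1 a b t) / o).
Proof.
move=> s0 st; under [X in Cintegral X]eq_fun do rewrite cexpi_trial.
pose H x : R[i] := (- bump a b x) +i* (- (bump1 a b x / o)).
transitivity (H t - H s); last first.
  by apply/eqP; rewrite eq_complex /=; apply/andP; split; apply/eqP; ring.
apply: Cintegral_FTC => //.
- move=> x /=; have := is_derive_bump a b x => db.
  by apply: is_derive_eq; rewrite /GRing.scale/=; ring.
- move=> x /=; have := is_derive_bump1 a b x => db.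
  by apply: is_derive_eq; rewrite /GRing.scale/=; ring.
- by move=> x /=; apply: cvgN; exact: continuous_bump1.
- move=> x /=; apply: cvgN; apply: cvgM; [exact: continuous_bump2|exact: cvg_cst].
Qed.

Lemma bump_bounds a b x : a <= x <= b ->
  `|bump1 a b x| <= (b - a) ^+ 3 / 2 /\ `|bump2 a b x| <= 2 * (b - a) ^+ 2.
Proof.
move=> /andP[ax xb].
set u := x - a; set v := b - x.
have u0 : 0 <= u by rewrite subr_ge0.
have v0 : 0 <= v by rewrite subr_ge0.
have h : b - a = u + v by rewrite /u /v; ring.
have e : a + b - 2 * x = v - u by rewrite /u /v; ring.
rewrite /bump1 /bump2 -/u -/v e h; split.
  rewrite normrM ger0_norm ?mulr_ge0//.
  have d : `|v - u| <= u + v by rewrite ler_norml; lra.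
  have p : 2 * (u * v) <= (u + v) ^+ 2 / 2 by have := sqr_ge0 (u - v); nra.
  have p0 : 0 <= 2 * (u * v) by rewrite !mulr_ge0.
  apply: le_trans (ler_pM p0 (normr_ge0 _) p d) _.
  by rewrite exprS; lra.
rewrite ler_norml; have := mulr_ge0 u0 v0; nra.
Qed.

(** On the middle half of the interval both factors of the bump are bounded
    below: their product is at least [3 / 16 * (b - a) ^+ 2]. *)
Lemma bump_lower a b x : a <= b ->
  a + (b - a) / 4 <= x <= b - (b - a) / 4 -> 9 / 256 * (b - a) ^+ 4 <= bump a b x.
Proof.
move=> ab /andP[ax xb]; rewrite /bump.
have [h hE] : exists h, h = b - a by exists (b - a).
have h0 : 0 <= h by rewrite hE subr_ge0.
rewrite -hE in ax xb *.
(* In terms of the distance r to the midpoint the product is a difference of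
   squares. *)
have [r rE] : exists r, r = x - a - h / 2 by eexists.
have -> : x - a = h / 2 + r by rewrite rE; ring.
have -> : b - x = h / 2 - r by rewrite rE; lra.
have r1 : - (h / 4) <= r <= h / 4 by rewrite rE; lra.
have : 3 / 16 * h ^+ 2 <= (h / 2 + r) * (h / 2 - r) by move/andP: r1 => [? ?]; nra.
move=> hp; have hp0 : 0 <= 3 / 16 * h ^+ 2 by rewrite mulr_ge0// sqr_ge0.
rewrite [X in X <= _](_ : _ = (3 / 16 * h ^+ 2) ^+ 2); last by field.
by rewrite ler_sqr// nnegrE (le_trans hp0).
Qed.

End trial_functions.

(** * Lower bound for the singular numbers *)

Section lower_bound.
Context {R : realType}.
Local Notation mu := (@lebesgue_measure R).
Local Open Scope complex_scope.
Implicit Types (f g : R -> R[i]) (a b o x y : R) (N n : nat).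

Definition bump_trial o a b x : R[i] := char `]a, b] x * trial o a b x.

Lemma Cmeasurable_trial o a b : Cmeasurable (trial o a b).
Proof.
by split; apply: measurable_funTS; apply: continuous_measurable_fun;
  [exact: continuous_trial_Re|exact: continuous_trial_Im].
Qed.

(** The bound for the squared modulus of [trial] on an interval of length [h]
    that comes from [bump_bounds]. *)
Definition trial_bound o h : R := h ^+ 4 * (h ^+ 2 / 4 + 4 / o ^+ 2).

Lemma trial_bound_ge0 o h : 0 <= trial_bound o h.
Proof.
rewrite /trial_bound mulr_ge0//; first by rewrite exprn_even_ge0.
by rewrite addr_ge0// divr_ge0// sqr_ge0.
Qed.

Lemma csq_trial_le o a b x : a <= x <= b ->
  csq (trial o a b x) <= trial_bound o (b - a).
Proof.
move=> /bump_bounds[h1 h2]; rewrite csq_trial /trial_bound.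
have e1 : bump1 a b x ^+ 2 <= ((b - a) ^+ 3 / 2) ^+ 2.
  rewrite -(real_normK (num_real (bump1 _ _ _))) ler_sqr// nnegrE//.
  exact: le_trans h1.
have e2 : bump2 a b x ^+ 2 <= (2 * (b - a) ^+ 2) ^+ 2.
  rewrite -(real_normK (num_real (bump2 _ _ _))) ler_sqr// nnegrE//.
  by rewrite mulr_ge0// sqr_ge0.
have e3 : (bump2 a b x / o) ^+ 2 <= (2 * (b - a) ^+ 2) ^+ 2 / o ^+ 2.
  by rewrite expr_div_n ler_wpM2r// invr_ge0 sqr_ge0.
apply: le_trans (lerD e1 e3) _.
rewrite le_eqVlt; apply/orP; left; apply/eqP.
by move: (o ^+ 2)^-1 => v; field.
Qed.

Lemma L2_char_trial o a b s t : 0 <= s -> s <= t -> a <= s -> t <= b ->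
  L2 (fun y => char `]s, t] y * trial o a b y).
Proof.
move=> s0 st as_ tb; apply: (L2_bounded _ s0 st (trial_bound_ge0 o (b - a))).
  apply: CmeasurableM; last exact: Cmeasurable_trial.
  by apply: Cmeasurable_char; exact: measurable_itv.
move=> y y0; rewrite csqM csq_char indicE.
case: (boolP (y \in `]s, t]%classic)) => [/set_mem|_]; last by rewrite mul0r mulr0.
rewrite /= in_itv/= => /andP[sy yt].
by rewrite mul1r mulr1 csq_trial_le// (le_trans as_ (ltW sy)) (le_trans yt).
Qed.

Lemma L2_bump_trial o a b : 0 <= a -> a <= b -> L2 (bump_trial o a b).
Proof. by move=> a0 ab; exact: L2_char_trial. Qed.

Lemma bump1_endpoints a b : (bump1 a b a = 0) * (bump1 a b b = 0).
Proof. by rewrite /bump1 !subrr mul0r mulr0 !mulr0 !mul0r. Qed.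

Lemma bump_endpoints a b : (bump a b a = 0) * (bump a b b = 0).
Proof. by rewrite /bump !subrr mul0r mulr0 !expr0n. Qed.

(** The trial function of an interval is mapped to a bump supported in the same
    interval: it is orthogonal to the constants and to the symbol, so nothing
    leaks out of the interval. *)
Lemma Q_bump_trial N a b x : (0 < N)%N -> 0 <= a -> a <= b -> b <= 1 -> 0 < x ->
  Q (phi_ N) (bump_trial (2 * pi * N%:R) a b) x =
  char `]a, b] x * (bump a b x)%:C.
Proof.
move=> N0 a0 ab b1 x0; set o := 2 * pi * N%:R.
have o0 : o != 0 by rewrite gt_eqF// !mulr_gt0 ?pi_gt0// ltr0n.
(* c is the point of [a, b] closest to x: for y in ]a, b], max (x, y) is x when
   y <= c and y otherwise. *)
pose c := Num.max a (Num.min x b).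
have ac : a <= c by rewrite /c le_max lexx.
have cb : c <= b by rewrite /c ge_max ab ge_min lexx orbT.
have c0 : 0 <= c by exact: le_trans ac.
have L1 := L2_char_trial o a0 ac (lexx a) cb.
have L3 := L2_char_trial o c0 cb ac (lexx b).
have -> : Q (phi_ N) (bump_trial o a b) x =
    Cintegral (fun y => phi_ N x * (char `]a, c] y * trial o a b y)
      + phi_ N y * (char `]c, b] y * trial o a b y)).
  rewrite /Q; apply: eq_Cintegral => y y0; rewrite /bump_trial.
  have [ya|ay] := leP y a.
    have n1 t : ~ (`]a, t]%classic y) by rewrite /= in_itv/= ltNge ya.
    rewrite !char0//; last by rewrite /= in_itv/= ltNge (le_trans ya ac).
    by rewrite !mul0r !mulr0 addr0.
  have [yb|yb] := leP y b; last first.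
    have n1 s : ~ (`]s, b]%classic y) by rewrite /= in_itv/= leNgt yb andbF.
    rewrite (char0 (n1 a)) (char0 (n1 c)) char0; last first.
      by rewrite /= in_itv/= leNgt (le_lt_trans cb yb) andbF.
    by rewrite !mul0r !mulr0 addr0.
  rewrite [X in _ * (X * _)]char1; last by rewrite /= in_itv/= ay.
  have [yc|cy] := leP y c.
    rewrite [X in _ = _ * (X * _) + _]char1; last by rewrite /= in_itv/= ay.
    rewrite char0; last by rewrite /= in_itv/= ltNge yc.
    have yx : y <= x.
      by move: yc; rewrite /c le_max leNgt ay/= le_min => /andP[].
    by rewrite max_l// mul0r mulr0 addr0.
  rewrite [X in _ = _ * (X * _) + _]char0; last first.
    by rewrite /= in_itv/= leNgt cy andbF.
  rewrite char1; last by rewrite /= in_itv/= cy.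
  have xy : x <= y.
    move: cy; rewrite /c gt_max => /andP[_]; rewrite gt_min (ltNge b) yb orbF.
    exact: ltW.
  by rewrite max_r// mul0r mulr0 add0r.
have I1 : Cintegrable (fun y => char `]a, c] y * trial o a b y).
  have L0 : L2 (char `]a, c] : R -> R[i]) by exact: L2_char.
  have := L2_Cintegrable L0 L1; congr Cintegrable; apply/funext => y.
  by rewrite mulrA /char indicE; case: (_ \in _); rewrite ?mul1r ?mul0r.
have I2 := L2_Cintegrable (L2_phi N) L3.
rewrite Cintegral_lin// Cintegral_trial//.
have -> : Cintegral (fun y => phi_ N y * (char `]c, b] y * trial o a b y)) =
    Cintegral (fun y => char `]c, b] y * (cexpi (o * y) * trial o a b y)).
  apply: eq_Cintegral => y y0; have [yb|yb] := leP y b.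
    by rewrite mulrCA phi_in// y0 (le_trans yb b1).
  by rewrite char0 ?mul0r ?mulr0//= in_itv/= leNgt yb andbF.
rewrite Cintegral_phase_trial// /trial_int !bump1_endpoints bump_endpoints.
(* When x is outside ]a, b], c is an end point and every boundary term
   vanishes. *)
have outside : c = a \/ c = b -> phi_ N x *
   (- sin (o * c) * bump1 a b c / o +i* (- cos (o * c) * bump1 a b c / o) -
    - sin (o * a) * 0 / o +i* (- cos (o * a) * 0 / o)) +
   (bump a b c - 0) +i* ((bump1 a b c - 0) / o) = 0.
  by case=> ->; rewrite !bump1_endpoints bump_endpoints !mulr0 !mul0r
    !subrr mul0r !mulr0 add0r.
have [xa|ax] := leP x a.
  rewrite outside; last by left; rewrite /c; apply/max_l; rewrite ge_min xa.
  by rewrite char0 ?mul0r//= in_itv/= ltNge xa.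
have [xb|bx] := leP x b; last first.
  rewrite outside; last first.
    by right; rewrite /c min_r ?(ltW bx)// max_r.
  by rewrite char0 ?mul0r//= in_itv/= leNgt bx andbF.
have -> : c = x by rewrite /c min_l// max_r// ltW.
rewrite char1 ?mul1r ?phi_in//; last 2 first.
- by rewrite x0 (le_trans xb b1).
- by rewrite /= in_itv/= ax.
rewrite /cexpi -/o; have := cos2Dsin2 (o * x).
set C := cos (o * x); set S := sin (o * x); set p := bump1 _ _ _.
move=> cs; apply/eqP; rewrite eq_complex; apply/andP; split; apply/eqP => /=.
  by ring.
transitivity ((1 - (C ^+ 2 + S ^+ 2)) * (p / o)); first by ring.
by rewrite cs subrr mul0r.
Qed.

Lemma Q_sum phi n (c : 'I_n -> R[i]) (f : 'I_n -> R -> R[i]) x :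
  L2 (fun y => phi (Num.max x y)) -> (forall i, L2 (f i)) ->
  Q phi (fun y => \sum_(i < n) c i * f i y) x = \sum_(i < n) c i * Q phi (f i) x.
Proof.
move=> Lphi; elim: n c f => [|n IH] c f Lf.
  rewrite big_ord0 /Q -[RHS]Cintegral0; apply: eq_Cintegral => y _.
  by rewrite big_ord0 mulr0.
rewrite big_ord_recl -IH//.
have LS : L2 (fun y => \sum_(i < n) c (lift ord0 i) * f (lift ord0 i) y).
  by apply: L2_sum => i; exact: L2Z.
rewrite /Q -Cintegral_lin; [|exact: L2_Cintegrable..].
by apply: eq_Cintegral => y _; rewrite big_ord_recl; ring.
Qed.

Lemma bounded_operator_sum (K : operator) n (c : 'I_n -> R[i])
    (f : 'I_n -> R -> R[i]) : bounded_operator K -> (forall i, L2 (f i)) ->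
  ae_eq mu Rplus (K (fun y => \sum_(i < n) c i * f i y))
    (fun x => \sum_(i < n) c i * K (f i) x).
Proof.
move=> bK; elim: n c f => [|n IH] c f Lf.
  have := bounded_operator_linear bK (- 1) L2_0 L2_0.
  under [X in K X]eq_fun do rewrite mulr0 addr0.
  rewrite (_ : (fun y => \sum_(i < 0) _) = fun=> 0); last first.
    by apply/funext => y; rewrite big_ord0.
  by apply: filterS => x /[apply] ->; rewrite big_ord0 mulN1r addNr.
have LS : L2 (fun y => \sum_(i < n) c (lift ord0 i) * f (lift ord0 i) y).
  by apply: L2_sum => i; exact: L2Z.
have := bounded_operator_linear bK (c ord0) (Lf ord0) LS.
rewrite (_ : (fun y => \sum_(i < n.+1) _) = fun y => c ord0 * f ord0 y +
    \sum_(i < n) c (lift ord0 i) * f (lift ord0 i) y); last first.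
  by apply/funext => y; rewrite big_ord_recl.
have Lf' (i : 'I_n) : L2 (f (lift ord0 i)) by [].
have := IH (fun i => c (lift ord0 i)) _ Lf'.
apply: (@filterS2 _ _ (ae_filter_ringOfSetsType mu)) => x h1 h2 x0.
by rewrite h2// h1// big_ord_recl.
Qed.

(** The [n + 1] images [K (f i)] lie in the span of [n] functions, so that some
    nontrivial combination of them vanishes; it can be normalized at will. *)
Lemma rank_le_kernel (K : operator) n (f : 'I_n.+1 -> R -> R[i]) (s : R) :
  bounded_operator K -> rank_le n K -> (forall i, L2 (f i)) -> 0 < s ->
  exists2 c : 'I_n.+1 -> R[i], \sum_(i < n.+1) csq (c i) = s &
    ae_eq mu Rplus (K (fun y => \sum_(i < n.+1) c i * f i y)) (fun=> 0).
Proof.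
move=> bK [g Lg hg] Lf s0.
have /choice[d dE] j : exists d : 'I_n -> R[i],
    ae_eq mu Rplus (K (f j)) (fun x => \sum_(i < n) d i * g i x) by exact: hg.
pose D : 'M[R[i]]_(n.+1, n) := \matrix_(j, i) d j i.
pose v0 := nz_row (kermx D).
have v0_neq0 : v0 != 0.
  rewrite /v0 nz_row_eq0 kermx_eq0 /row_free neq_ltn.
  by rewrite ltnS rank_leq_col.
have v0D : v0 *m D = 0 by apply/sub_kermxP; exact: nz_row_sub.
pose q := \sum_(i < n.+1) csq (v0 0 i).
have q0 : 0 < q.
  have [i vi] := rV0Pn _ v0_neq0.
  rewrite /q (bigD1 i)//= ltr_wpDr ?csq_gt0// sumr_ge0// => j _.
  exact: csq_ge0.
have [v vs vD] : exists2 v : 'rV_n.+1, \sum_(i < n.+1) csq (v 0 i) = s &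
    v *m D = 0.
  exists ((Num.sqrt (s / q))%:C *: v0); last by rewrite -scalemxAl v0D scaler0.
  under eq_bigr do rewrite mxE csqM csq_real sqr_sqrtr ?divr_ge0 ?(ltW s0) ?(ltW q0)//.
  by rewrite -mulr_sumr divfK// gt_eqF.
exists (fun j => v 0 j) => //.
have all_d : \forall x \ae mu, forall j, Rplus x ->
    K (f j) x = \sum_(i < n) d j i * g i x.
  by apply: filter_forall => j; exact: dE.
have := bounded_operator_sum (fun j => v 0 j) bK Lf.
apply: (@filterS2 _ _ (ae_filter_ringOfSetsType mu) _ _ _ _ all_d).
move=> x hd h x0; rewrite h//.
under eq_bigr do rewrite hd// mulr_sumr.
rewrite exchange_big big1 //= => i _.
under eq_bigr do rewrite mulrA.
rewrite -mulr_suml (_ : \sum_(j < n.+1) _ = 0) ?mul0r//.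
have := congr1 (fun A : 'rV[R[i]]_n => A 0 i) vD; rewrite !mxE.
by apply: etrans; apply: eq_bigr => j _; rewrite mxE.
Qed.

End lower_bound.

Section lower_bound_energy.
Context {R : realType}.
Local Notation mu := (@lebesgue_measure R).
Local Open Scope complex_scope.
Implicit Types (f g : R -> R[i]) (a b o x y : R) (N n m : nat).

(** Functions supported in different blocks are orthogonal, already
    pointwise. *)
Lemma csq_sum_block m (c u : 'I_m -> R[i]) x :
  csq (\sum_(j < m) c j * (char (block m j) x * u j)) =
  \sum_(j < m) csq (c j) * csq (u j) * \1_(block m j) x.
Proof.
have [[k kx]|no] := pselect (exists k : 'I_m, block m k x).
  under eq_bigr do rewrite mulrCA.
  rewrite (sum_block (k := k) _ (fun l : 'I_m => char_block l kx)) csqM.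
  under eq_bigr do rewrite mulrC.
  by rewrite (sum_block (k := k) _ (fun l : 'I_m => indic_block l kx)).
rewrite !big1 ?csq0// => j _.
- by rewrite indicE memNset ?mulr0// => jx; apply: no; exists j.
- by rewrite char0 ?mul0r ?mulr0// => jx; apply: no; exists j.
Qed.

Definition block_trial o m (j : nat) : R -> R[i] :=
  bump_trial o (j%:R / m%:R) (j.+1%:R / m%:R).

Lemma L2_block_trial o m (j : 'I_m) : L2 (block_trial o m j).
Proof. by have [? ? _] := block_endpoints R (ltn_ord j); exact: L2_bump_trial. Qed.

Lemma energy_block_trials_le o m (c : 'I_m -> R[i]) : (0 < m)%N ->
  (energy (fun y => (\sum_(j < m) c j * block_trial o m j y)%R) <=
   ((\sum_(j < m) csq (c j)) * (trial_bound o m%:R^-1 * m%:R^-1))%:E)%E.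
Proof.
move=> m0.
pose a j : R := j%:R / m%:R; pose b j : R := j.+1%:R / m%:R.
pose t (j : 'I_m) := csq (c j) * trial_bound o m%:R^-1.
apply: (@le_trans _ _ (\int[mu]_(x in Rplus)
    (\sum_(j < m) t j * \1_(`]a j, b j]) x)%R%:E)%E).
  apply: ge0_le_integral_nomeas => x _; first by rewrite lee_fin csq_ge0.
  rewrite lee_fin csq_sum_block; apply: ler_sum => j _.
  rewrite indicE; case: (boolP (_ \in _)) => [/set_mem jx|_]; last by rewrite !mulr0.
  rewrite !mulr1 ler_wpM2l ?csq_ge0//.
  have /(csq_trial_le o) : a j <= x <= b j.
    by move: jx => /in_block/andP[/ltW ? ?]; apply/andP.
  by rewrite /a /b block_length.
rewrite integral_sum_indic; last 3 first.
- by move=> j; have [] := block_endpoints R (ltn_ord j).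
- by move=> j; have [] := block_endpoints R (ltn_ord j).
- by move=> j; rewrite mulr_ge0 ?csq_ge0 ?trial_bound_ge0.
rewrite lee_fin mulr_suml; apply: ler_sum => j _.
by rewrite /a /b block_length// mulrA.
Qed.

Lemma Q_block_trials N m (c : 'I_m -> R[i]) x : (0 < N)%N -> 0 < x ->
  Q (phi_ N) (fun y => \sum_(j < m) c j * block_trial (2 * pi * N%:R) m j y) x =
  \sum_(j < m) c j * (char (block m j) x *
    (bump (j%:R / m%:R) (j.+1%:R / m%:R) x)%:C).
Proof.
move=> N0 x0.
rewrite Q_sum; [|exact: L2_phi_max|by move=> j; exact: L2_block_trial].
apply: eq_bigr => j _; congr (_ * _).
by have [? ? ?] := block_endpoints R (ltn_ord j); exact: Q_bump_trial.
Qed.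

Lemma Cmeasurable_Q_block_trials N m (c : 'I_m -> R[i]) : (0 < N)%N ->
  Cmeasurable (Q (phi_ N)
    (fun y => \sum_(j < m) c j * block_trial (2 * pi * N%:R) m j y)).
Proof.
move=> N0; set g := Q _ _.
pose u x := \sum_(j < m) c j * (char (block m j) x *
    (bump (j%:R / m%:R) (j.+1%:R / m%:R) x)%:C).
have gu x : x \in (Rplus : set R) -> u x = g x.
  by rewrite inE /Rplus /= in_itv/= andbT => x0; rewrite /g Q_block_trials.
have [mr mi] : Cmeasurable u.
  apply: Cmeasurable_sum => j; apply: CmeasurableM; first exact: Cmeasurable_cst.
  apply: CmeasurableM; first by apply: Cmeasurable_char; exact: measurable_itv.
  split => /=; last exact: measurable_cst.
  by apply: measurable_funTS; apply: continuous_measurable_fun; exact: continuous_bump.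
by split; [move: mr|move: mi]; apply: eq_measurable_fun => x /gu <-.
Qed.

(** Only the middle half of each block is used. *)
Lemma energy_Q_block_trials_ge N m (c : 'I_m -> R[i]) : (0 < N)%N -> (0 < m)%N ->
  (((\sum_(j < m) csq (c j)) *
     ((9 / 256 * m%:R^-1 ^+ 4) ^+ 2 * (m%:R^-1 / 2)))%:E <=
   energy (Q (phi_ N)
     (fun y => (\sum_(j < m) c j * block_trial (2 * pi * N%:R) m j y)%R)))%E.
Proof.
move=> N0 m0.
pose h : R := m%:R^-1.
have h0 : 0 < h by rewrite invr_gt0 ltr0n.
pose a j : R := j%:R / m%:R; pose b j : R := j.+1%:R / m%:R.
have ab j : b j - a j = h by exact: block_length.
pose a' (j : 'I_m) : R := a j + h / 4; pose b' (j : 'I_m) : R := b j - h / 4.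
pose t (j : 'I_m) := csq (c j) * (9 / 256 * h ^+ 4) ^+ 2.
have a'0 j : 0 <= a' j.
  by rewrite /a' addr_ge0 ?divr_ge0 ?(ltW h0)//;
    have [] := block_endpoints R (ltn_ord j).
have ab' j : a' j <= b' j.
  by have := ab j; rewrite /a' /b'; lra.
have t0 j : 0 <= t j by rewrite mulr_ge0 ?csq_ge0 ?sqr_ge0.
apply: (@le_trans _ _ (\int[mu]_(x in Rplus)
    (\sum_(j < m) t j * \1_(`]a' j, b' j]) x)%R%:E)%E).
  rewrite integral_sum_indic// lee_fin mulr_suml; apply: ler_sum => j _.
  have -> : b' j - a' j = h / 2 by have := ab j; rewrite /a' /b'; lra.
  by rewrite /t -[X in _ <= X]mulrA.
apply: ge0_le_integral_nomeas => x.
  by rewrite lee_fin sumr_ge0// => j _; rewrite mulr_ge0.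
rewrite /Rplus /= in_itv/= andbT => x0.
rewrite lee_fin Q_block_trials// csq_sum_block; apply: ler_sum => j _.
rewrite indicE; case: (boolP (_ \in _)) => [/set_mem|_]; last first.
  by rewrite mulr0 mulr_ge0// mulr_ge0// csq_ge0.
rewrite /= in_itv/= => /andP[jx xj].
rewrite indicE mem_set; last first.
  apply/in_block; move: jx xj; rewrite /a' /b' /a /b => jx xj.
  by apply/andP; split; lra.
rewrite !mulr1 /t ler_wpM2l ?csq_ge0// csq_real.
have l : 9 / 256 * h ^+ 4 <= bump (a j) (b j) x.
  rewrite -(ab j); apply: bump_lower; first by rewrite -subr_ge0 ab ltW.
  by rewrite ab (ltW jx) xj.
have l0 : 0 <= 9 / 256 * h ^+ 4 by rewrite mulr_ge0// exprn_even_ge0.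
by rewrite ler_sqr// nnegrE (le_trans l0).
Qed.

Lemma energy_sub_ae_null f g : Cmeasurable f -> Cmeasurable g ->
  ae_eq mu Rplus g (fun=> 0) -> energy (fun x => f x - g x) = energy f.
Proof.
move=> mf mg g0; apply: ge0_ae_eq_integral => //.
- apply: measurable_csq; apply: CmeasurableD => //.
  rewrite (_ : (fun _ => _) = fun x => -1 * g x); last first.
    by apply/funext => x; rewrite mulN1r.
  by apply: CmeasurableM => //; exact: Cmeasurable_cst.
- exact: measurable_csq.
- by move=> x _; rewrite lee_fin csq_ge0.
- by move=> x _; rewrite lee_fin csq_ge0.
- by apply: filterS g0 => x /[apply] ->; rewrite subr0.
Qed.

(** Compares the bounds for the input and the output of a trial function on a
    block of length [h], for the frequency [4 * t].  Since [4 <= 2 * pi], the frequency of the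
    symbol is at least [4 * N], and [trial_bound] decreases with the
    frequency. *)
Lemma trial_ratio (h t : R) : 0 < h -> 0 < t ->
  (1 / 32 * Num.min h (t * h ^+ 2)) ^+ 2 * trial_bound (4 * t) h * h <=
  (9 / 256 * h ^+ 4) ^+ 2 * (h / 2).
Proof.
move=> h0 t0.
pose q := Num.min h (t * h ^+ 2).
have h2 : 0 < h ^+ 2 by rewrite exprn_gt0.
have t2 : 0 < t ^+ 2 by rewrite exprn_gt0.
have q0 : 0 <= q by rewrite le_min !mulr_ge0 ?ltW.
have q1 : q ^+ 2 <= h ^+ 2.
  by rewrite ler_sqr ?nnegrE ?(ltW h0)// ge_min lexx.
have q2 : q ^+ 2 <= t ^+ 2 * h ^+ 4.
  rewrite (_ : t ^+ 2 * h ^+ 4 = (t * h ^+ 2) ^+ 2); last by ring.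
  rewrite ler_sqr ?nnegrE//; last by rewrite mulr_ge0// ltW.
  by rewrite ge_min lexx orbT.
have q3 : q ^+ 2 / t ^+ 2 <= h ^+ 4 by rewrite ler_pdivrMr// mulrC.
have q4 : q ^+ 2 * h ^+ 2 <= h ^+ 4.
  by rewrite (_ : h ^+ 4 = h ^+ 2 * h ^+ 2); [rewrite ler_wpM2r// ltW|ring].
have h5 : 0 < h ^+ 5 by rewrite exprn_gt0.
have -> : (1 / 32 * q) ^+ 2 * trial_bound (4 * t) h * h
  = h ^+ 5 * ((1 / 64) ^+ 2 * (q ^+ 2 * h ^+ 2 + q ^+ 2 / t ^+ 2)).
  by rewrite /trial_bound; field; rewrite gt_eqF.
have -> : (9 / 256 * h ^+ 4) ^+ 2 * (h / 2) = h ^+ 5 * ((9 / 256) ^+ 2 / 2 * h ^+ 4).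
  by ring.
rewrite ler_wpM2l ?(ltW h5)//.
have s0 : 0 <= (1 / 64) ^+ 2 :> R by exact: sqr_ge0.
apply: le_trans (ler_wpM2l s0 (lerD q4 q3)) _.
rewrite -mulr2n mulrnAr -mulrnAl ler_wpM2r ?exprn_even_ge0//.
by rewrite mulr2n !expr2; lra.
Qed.

Lemma trial_bound_decr (o o' h : R) : 0 < o -> o <= o' ->
  trial_bound o' h <= trial_bound o h.
Proof.
move=> o0 oo; rewrite /trial_bound ler_wpM2l//; first by rewrite exprn_even_ge0.
rewrite lerD2l ler_pM2l// lef_pV2 ?posrE ?exprn_gt0 ?(lt_le_trans o0)//.
by rewrite ler_sqr ?nnegrE ?(ltW o0)// (le_trans (ltW o0)).
Qed.

Lemma singular_number_lower N n : (1 <= N)%N ->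
  ((1 / 32 * Num.min (1 / n.+1%:R) (N%:R / n.+1%:R ^+ 2) : R)%:E <=
   singular_number (Q (phi_ N)) n)%E.
Proof.
move=> N1.
pose h : R := n.+1%:R^-1.
have h0 : 0 < h by rewrite invr_gt0.
have NR : 0 < N%:R :> R by rewrite ltr0n.
pose o : R := 2 * pi * N%:R.
have oN : 4 * N%:R <= o by rewrite /o ler_pM2r//; have := @pi_ge2 R; lra.
have -> : Num.min (1 / n.+1%:R) (N%:R / n.+1%:R ^+ 2) = Num.min h (N%:R * h ^+ 2).
  by rewrite div1r -exprVn.
set r := 1 / 32 * _.
have r0 : 0 <= r.
  by rewrite mulr_ge0// le_min !mulr_ge0 ?sqr_ge0 ?ltW.
have B0 : 0 < trial_bound o h.
  rewrite /trial_bound mulr_gt0 ?exprn_gt0// ltr_wpDr ?divr_gt0 ?exprn_gt0//.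
  by rewrite divr_ge0// sqr_ge0.
apply: le_ereal_inf_tmp => _ [K [bK rK] <-].
pose f (j : 'I_n.+1) := block_trial o n.+1 j.
have Lf j : L2 (f j) by exact: L2_block_trial.
(* This normalization of the coefficients makes the trial combination a vector
   of norm at most 1. *)
pose s := (trial_bound o h * h)^-1.
have s0 : 0 < s by rewrite invr_gt0 mulr_gt0.
have [c cs Kc] := rank_le_kernel bK rK Lf s0.
pose F y := \sum_(j < n.+1) c j * f j y.
have LF : L2 F by apply: L2_sum => j; exact: L2Z.
have F1 : (energy F <= 1)%E.
  apply: le_trans (energy_block_trials_le o c (ltn0Sn n)) _.
  by rewrite cs lee_fin mulVf// gt_eqF// mulr_gt0.
have mQ : Cmeasurable (Q (phi_ N) F) by exact: Cmeasurable_Q_block_trials.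
apply: (@le_trans _ _ (L2norm (fun x => Q (phi_ N) F x - K F x))); last first.
  apply: ereal_sup_ubound; exists F => //; split => //.
  by apply/(L2norm_leP _ ler01); rewrite expr1n.
apply/L2norm_geP => //; rewrite energy_sub_ae_null//; last first.
  by apply: L2_cmeas; exact: bounded_operator_L2.
apply: le_trans (energy_Q_block_trials_ge c N1 (ltn0Sn n)).
rewrite cs lee_fin -/h -/o.
have -> : r ^+ 2 = s * (trial_bound o h * h * r ^+ 2).
  by rewrite mulKf// gt_eqF// mulr_gt0.
rewrite ler_wpM2l ?(ltW s0)//.
apply: le_trans _ (trial_ratio h0 NR).
rewrite mulrC mulrA ler_wpM2r ?(ltW h0)// ler_wpM2l ?sqr_ge0//.
by apply: trial_bound_decr => //; rewrite mulr_gt0.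
Qed.

End lower_bound_energy.

(** * Trace norm *)

Section trace_norm_bounds.
Context {R : realType}.
Implicit Types (N n k : nat) (x : R).

Definition rate N n : R := Num.min (1 / n.+1%:R) (N%:R / n.+1%:R ^+ 2).

Lemma rate_ge0 N n : 0 <= rate N n.
Proof. by rewrite le_min !divr_ge0// exprn_ge0. Qed.

Lemma ln_step_upper k : (0 < k)%N -> ln k%:R + 1 / k.+1%:R <= ln k.+1%:R :> R.
Proof.
move=> k0; have kp : 0 < k%:R :> R by rewrite ltr0n.
have kp1 : 0 < k.+1%:R :> R by rewrite ltr0n.
have e : k%:R = k.+1%:R * (1 + - (1 / k.+1%:R)) :> R.
  by rewrite -natr1; field; rewrite natr1 gt_eqF.
have p : 0 < 1 + - (1 / k.+1%:R) :> R by rewrite -(pmulr_rgt0 _ kp1) -e.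
have l : ln (1 + - (1 / k.+1%:R)) <= - (1 / k.+1%:R) :> R.
  by apply: le_ln1Dx; rewrite -subr_gt0 opprK addrC.
rewrite [X in ln X + _]e lnM ?posrE//.
by rewrite -addrA -[X in _ <= X]addr0 lerD2l -lerBrDr sub0r.
Qed.

Lemma ln_step_lower k : ln k.+2%:R <= ln k.+1%:R + 1 / k.+1%:R :> R.
Proof.
have kp1 : 0 < k.+1%:R :> R by rewrite ltr0n.
have e : k.+2%:R = k.+1%:R * (1 + 1 / k.+1%:R) :> R.
  by rewrite -natr1; field; rewrite gt_eqF.
have p : 0 <= 1 / k.+1%:R :> R by rewrite divr_ge0.
have l : ln (1 + 1 / k.+1%:R) <= 1 / k.+1%:R :> R.
  by apply: le_ln1Dx; exact: lt_le_trans (ltrN10 _) p.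
by rewrite e lnM ?posrE// ?ltr_wpDr// lerD2l.
Qed.

Lemma sum_rate_lower N : ln N.+1%:R <= \sum_(0 <= n < N) rate N n :> R.
Proof.
have H k : (k <= N)%N -> ln k.+1%:R <= \sum_(0 <= n < k) rate N n :> R.
  elim: k => [|k IH] kN; first by rewrite ln1 big_geq.
  rewrite big_nat_recr//=; apply: le_trans (ln_step_lower k) _.
  apply: lerD; first exact: IH (ltnW kN).
  have kp1 : 0 < k.+1%:R :> R by rewrite ltr0n.
  rewrite /rate le_min lexx /= ler_pdivrMr// expr2 invfM mulrA mulfVK ?gt_eqF//.
  by rewrite ler_pdivlMr// mul1r ler_nat.
exact: H.
Qed.

(** Up to [N] the sum is harmonic; beyond [N] the terms [N / (n + 1) ^ 2] are
    dominated by the telescoping [N / n - N / (n + 1)]. *)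
Lemma sum_rate_upper N k : (0 < N)%N -> \sum_(0 <= n < k) rate N n <= 2 + ln N%:R :> R.
Proof.
move=> N0; have Np : 0 < N%:R :> R by rewrite ltr0n.
have H1 j : (0 < j)%N -> (j <= N)%N -> \sum_(0 <= n < j) rate N n <= 1 + ln j%:R :> R.
  elim: j => // j IH _ jN; rewrite big_nat_recr//=.
  have r1 : rate N j <= 1 / j.+1%:R by rewrite /rate ge_min lexx.
  case: j IH jN r1 => [|j] IH jN r1.
    by rewrite big_geq// ln1 addr0 add0r (le_trans r1)// divr1.
  apply: le_trans (lerD (IH isT (ltnW jN)) r1) _.
  by rewrite -addrA lerD2l ln_step_upper.
have H2 j : (N <= j)%N ->
    \sum_(0 <= n < j) rate N n <= 2 + ln N%:R - N%:R / j%:R :> R.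
  elim: j => [|j IH] Nj; first by move: N0; rewrite ltnNge Nj.
  move: Nj; rewrite leq_eqVlt => /predU1P[Nj|Nj].
    by rewrite -Nj divff ?gt_eqF//; have := H1 _ N0 (leqnn N); lra.
  have jp : 0 < j%:R :> R by rewrite ltr0n (leq_trans N0).
  rewrite big_nat_recr//=.
  have r2 : rate N j <= N%:R / j.+1%:R ^+ 2 by rewrite /rate ge_min lexx orbT.
  suff s : N%:R / j.+1%:R ^+ 2 <= N%:R / j%:R - N%:R / j.+1%:R :> R.
    by apply: le_trans (lerD (IH Nj) (le_trans r2 s)) _; rewrite addrA subrK.
  rewrite -natr1 [X in _ <= X](_ : _ = N%:R / (j%:R * (j%:R + 1))); last first.
    by field; rewrite gt_eqF//= gt_eqF// ltr_wpDr.
  rewrite ler_pM2l// lef_pV2 ?posrE ?exprn_gt0 ?mulr_gt0 ?ltr_wpDr//.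
  by rewrite expr2 ler_pM2r ?ltr_wpDr// lerDl.
have l0 : 0 <= ln N%:R :> R by rewrite ln_ge0// ler1n.
have [kN|Nk] := leqP k N.
  case: k kN => [|k] kN; first by rewrite big_geq//; lra.
  apply: le_trans (H1 k.+1 isT kN) _.
  have : ln k.+1%:R <= ln N%:R :> R by rewrite ler_ln ?posrE// ler_nat.
  lra.
apply: le_trans (H2 _ (ltnW Nk)) _.
by rewrite gerDl oppr_le0 divr_ge0.
Qed.

Lemma ln_succ_bound N : (0 < N)%N -> 2 + ln N%:R <= 5 * ln N.+1%:R :> R.
Proof.
move=> N0; have Np : 0 < N%:R :> R by rewrite ltr0n.
have l1 : ln N%:R <= ln N.+1%:R :> R by rewrite ler_ln ?posrE// ler_nat.
have l2 : ln 2 <= ln N.+1%:R :> R by rewrite ler_ln ?posrE// ler_nat.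
have := @ln_step_upper 1 isT; rewrite ln1; lra.
Qed.

End trace_norm_bounds.

Theorem theorem6p5 (R : realType) :
  (exists c C : R, [/\ 0 < c, 0 < C & forall n N : nat, (1 <= N)%N ->
    let m : R := Num.min (1 / n.+1%:R) (N%:R / n.+1%:R ^+ 2) in
    ((c * m)%:E <= singular_number (Q (phi_ N)) n)%E /\
    (singular_number (Q (phi_ N)) n <= (C * m)%:E)%E]) /\
  (exists c C : R, [/\ 0 < c, 0 < C & forall N : nat, (1 <= N)%N ->
    ((c * ln (N.+1%:R : R))%:E <= trace_norm (Q (phi_ (R := R) N)))%E /\
    (trace_norm (Q (phi_ (R := R) N)) <= (C * ln (N.+1%:R : R))%:E)%E]).
Proof.
have lower n N : (1 <= N)%N ->
    ((1 / 32 * rate N n : R)%:E <= singular_number (Q (phi_ N)) n)%E.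
  exact: singular_number_lower.
have upper n N : (1 <= N)%N ->
    (singular_number (Q (phi_ N)) n <= (256 * rate N n : R)%:E)%E.
  exact: singular_number_upper.
have s0 n N : (1 <= N)%N -> (0 <= singular_number (Q (phi_ (R := R) N)) n)%E.
  move=> N1; apply: le_trans (lower n N N1).
  by rewrite lee_fin mulr_ge0 ?rate_ge0.
split.
  exists (1 / 32), 256; split=> // n N N1.
  by split; [exact: lower|exact: upper].
exists (1 / 32), (256 * 5); split=> // N N1; split.
  apply: le_trans (nneseries_lim_ge N _); last by move=> n _ _; exact: s0.
  apply: (@le_trans _ _ (\sum_(0 <= n < N) (1 / 32 * rate N n)%:E)%E).
    by rewrite sumEFin lee_fin -mulr_sumr ler_wpM2l// sum_rate_lower.
  by apply: lee_sum => n _; exact: lower.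
apply: lime_le; first by apply: is_cvg_nneseries => n _ _; exact: s0.
apply: nearW => k.
apply: (@le_trans _ _ (\sum_(0 <= n < k) (256 * rate N n)%:E)%E).
  by apply: lee_sum => n _; exact: upper.
rewrite sumEFin lee_fin -mulr_sumr -mulrA ler_wpM2l//.
by apply: le_trans (ln_succ_bound N1); exact: sum_rate_upper.
Qed.
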